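(* Let $x\in\partial\Omega$. Then the following are equivalent: (a) $x$ is accessible; (b) there is an end $[E_k]$ with $I[E_k]=\{x\}$; (c) there is a prime end $[E_k]$ with $I[E_k]=\{x\}$. If $1\le p\in Q(x)$ and $Q(x)\ne(0,1]$, then also the following statements are equivalent to (a)–(c): (d) there is a $\mathrm{Mod}_p$-end $[E_k]$ with $I[E_k]=\{x\}$; (e) there is a $\mathrm{Mod}_p$-prime end $[E_k]$ with $I[E_k]=\{x\}$.
   Context: Setting: $(X,d,\mu)$ is a metric measure space with more than one point, $\mu$ is a Borel measure with $0<\mu(B)<\infty$ for all balls $B$, and $1\le p<\infty$ is fixed. $X$ is complete, $\mu$ is doubling (there is $C_\mu>0$ with $\mu(B(x,2r))\le C_\mu\mu(B(x,r))$ for all balls), and $X$ supports a $p$-Poincaré inequality: there are $C_{PI}>0$, $\lambda\ge1$ such that for all balls $B$ and all $u\in N^{1,p}(X)$, $\frac{1}{\mu(B)}\int_B|u-u_B|\,d\mu\le C_{PI}\operatorname{diam}(B)\bigl(\frac{1}{\mu(\lambda B)}\int_{\lambda B}g_u^p\,d\mu\bigr)^{1/p}$, where $u_B=\frac{1}{\mu(B)}\int_B u\,d\mu$. Here a nonnegative Borel function $g$ is an upper gradient of $u:X\to[-\infty,\infty]$ if for every nonconstant rectifiable curve $\gamma:[0,l_\gamma]\to X$ parameterized by arc length, $|u(\gamma(0))-u(\gamma(l_\gamma))|\le\int_\gamma g\,ds$ when both values are finite, and $\int_\gamma g\,ds=\infty$ otherwise; $N^{1,p}(X)$ is the space of measurable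 $u$ with $\int_X|u|^p\,d\mu+\inf_g\int_X g^p\,d\mu<\infty$ (infimum over upper gradients $g$ of $u$), and $g_u$ is the minimal $p$-weak upper gradient of $u$ (the a.e.-smallest $L^p$ function satisfying the upper gradient inequality for all curves except a family $\Gamma$ for which some nonnegative Borel $\rho\in L^p(X)$ has $\int_\gamma\rho\,ds=\infty$ for all $\gamma\in\Gamma$). $\Omega\subsetneq X$ is a bounded domain (bounded nonempty connected open set); closures and boundaries of subsets of $\Omega$ are taken in $X$. Ends: A bounded connected set $E\subsetneq\Omega$ is acceptable if $\overline E\cap\partial\Omega\ne\varnothing$. A sequence $\{E_k\}_{k=1}^\infty$ of acceptable sets is a chain if (i) $E_{k+1}\subset E_k$ for all $k$; (ii) $\operatorname{dist}(\Omega\cap\partial E_{k+1},\Omega\cap\partial E_k)>0$ for all $k$; (iii) the impression $\bigcap_{k=1}^\infty\overline{E}_k$ is contained in $\partial\Omega$. A chain $\{E_k\}$ divides a chain $\{F_k\}$ if for each $k$ there is $l$ with $E_l\subset F_k$. Two chains are equivalent if they divide each other; an end $[E_k]$ is an equivalence class of chains, and its impression $I[E_k]$ is the impression of any representative chain. Division is well defined between ends. A prime end is an end that is not divisible by any other end. Accessibility: $x\in\partial\Omega$ is accessible if there is a (possibly nonrectifiable) curve $\gamma:[0,1]\to X$ with $\gamma(1)=x$ and $\gamma([0,1))\subset\Omega$. Modulus: for a family $\Gamma$ of nonconstant rectifiable curves, $\mathrm{Mod}_p(\Gamma)=\inf_\rho\int_X\rho^p\,d\mu$, the infimum over nonnegative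 Borel $\rho$ with $\int_\gamma\rho\,ds\ge1$ for all $\gamma\in\Gamma$. $\mathrm{Mod}_p(E,F,U)$ is the $p$-modulus of the family of nonconstant rectifiable curves in $U$ starting in $E$ and ending in $F$. A chain $\{E_k\}$ is a $\mathrm{Mod}_p$-chain if $\lim_{k\to\infty}\mathrm{Mod}_p(E_k,K,\Omega)=0$ for every compact $K\subset\Omega$. An end is a $\mathrm{Mod}_p$-end if some $\mathrm{Mod}_p$-chain represents it. A $\mathrm{Mod}_p$-end is a $\mathrm{Mod}_p$-prime end if the only $\mathrm{Mod}_p$-end dividing it is itself. Pointwise dimension set: $Q(x)$ is the set of all $q>0$ for which there are $C_q,R_q>0$ with $\frac{\mu(B(x,r))}{\mu(B(x,R))}\le C_q(r/R)^q$ for all $0<r\le R\le R_q$ (it is a bounded interval with left end point $0$). *)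

(* Defs.v *)
(* Analysis on metric measure spaces, over an arbitrary R : realType. *)
From HB Require Import structures.
From mathcomp Require Import all_boot all_order all_algebra.
From mathcomp Require Import all_classical all_reals all_analysis.
From mathcomp Require Import measurable_realfun.

Set Implicit Arguments.
Unset Strict Implicit.
Unset Printing Implicit Defensive.

Import Order.TTheory GRing.Theory Num.Theory.
Import numFieldNormedType.Exports.

Local Open Scope classical_set_scope.
Local Open Scope ring_scope.

(* The library has no join of its complete and metric structures. Completeness
   brings a base point with it, which only records that the space is nonempty. *)
#[short(type="completeMetricType")]
HB.structure Definition CompleteMetric (R : numDomainType) :=
  { T of Complete T & Metric R T }.

Notation borel X := (g_sigma_algebraType (@open X)).

Section metric_notions.
Context {R : realType} {X : metricType R}.
Implicit Types (A B : set X) (g : R -> X).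

(* diam set0 = -oo and dist A set0 = +oo. *)
Definition diam A : \bar R :=
  ereal_sup [set (mdist x y)%:E | x in A & y in A].

Definition dist A B : \bar R :=
  ereal_inf [set (mdist x y)%:E | x in A & y in B].

Definition metric_bounded A := (diam A < +oo)%E.

Definition boundary A := closure A `\` A°.

(* The sum over the partition s follows [variation] of the library, which is
   restricted to real-valued functions. *)
Definition curve_length (a b : R) g : \bar R :=
  ereal_sup [set (let F := g \o nth b (a :: s) in
                  \sum_(0 <= n < size s) mdist (F n) (F n.+1))%:E
            | s in itv_partition a b].

(* A nonconstant rectifiable curve parameterized by arc length on [0, l] is a
   pair (l, g); the values of g outside [0, l] are irrelevant. *)
Definition arclength_curve (c : R * (R -> X)) :=
  [/\ 0 < c.1,
      {within `[0, c.1], continuous c.2} &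
      forall t, 0 <= t <= c.1 -> curve_length 0 t c.2 = t%:E].

Definition line_integral (c : R * (R -> X)) (rho : X -> \bar R) : \bar R :=
  (\int[lebesgue_measure]_(t in `[0%R, c.1]) rho (c.2 t))%E.

Definition curves_between A B (U : set X) : set (R * (R -> X)) :=
  [set c | [/\ arclength_curve c, A (c.2 0), B (c.2 c.1) &
               forall t, 0 <= t <= c.1 -> U (c.2 t)]].

Definition accessible (Omega : set X) (x : X) :=
  exists g : R -> X, [/\ {within `[0, 1], continuous g}, g 1 = x &
    forall t, 0 <= t < 1 -> Omega (g t)].

End metric_notions.

Section ends.
Context {R : realType} {X : metricType R}.
Implicit Types (Omega A : set X) (E F : nat -> set X)
  (e f : set (nat -> set X)).

Definition bounded_domain Omega :=
  [/\ open Omega, connected Omega, Omega !=set0 & metric_bounded Omega].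

Definition acceptable Omega A :=
  [/\ metric_bounded A, connected A, A `<` Omega &
      closure A `&` boundary Omega !=set0].

Definition impression E := \bigcap_k closure (E k).

Definition chain Omega E :=
  [/\ forall k, acceptable Omega (E k),
      forall k, E k.+1 `<=` E k,
      forall k, (0 < dist (Omega `&` boundary (E k.+1))
                          (Omega `&` boundary (E k)))%E &
      impression E `<=` boundary Omega].

Definition chain_divides E F := forall k, exists l, E l `<=` F k.

Definition chain_equiv E F := chain_divides E F /\ chain_divides F E.

Definition end_of Omega E := [set F | chain Omega F /\ chain_equiv E F].

Definition is_end Omega e := exists2 E, chain Omega E & e = end_of Omega E.

(* Equivalent chains have the same impression, so the union is the impression
   of any single representative. *)
Definition end_impression e := \bigcup_(E in e) impression E.

Definition end_divides e f :=
  exists2 E, e E & exists2 F, f F & chain_divides E F.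

Definition is_prime_end Omega e :=
  is_end Omega e /\ forall f, is_end Omega f -> end_divides f e -> f = e.

End ends.

Section metric_measure.
Context {R : realType} {X : completeMetricType R}.
Variables (mu : {measure set (borel X) -> \bar R}) (p : R).
Implicit Types (u g rho : X -> \bar R) (G : set (R * (R -> X))).

Definition nonneg_borel g :=
  measurable_fun setT (g : borel X -> \bar R) /\ forall x, (0 <= g x)%E.

Definition ppower_integral u : \bar R := (\int[mu]_x (`|u x| `^ p))%E.

Definition doubling := exists2 C : R, 0 < C & forall (x : X) (r : R), 0 < r ->
  (mu (ball x (2 * r)) <= C%:E * mu (ball x r))%E.

Definition gradient_ineq u g (c : R * (R -> X)) :=
  let finite_ends := u (c.2 0%R) \is a fin_num /\ u (c.2 c.1) \is a fin_num in
  (finite_ends ->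
     (`|u (c.2 0%R) - u (c.2 c.1)| <= line_integral c g)%E) /\
  (~ finite_ends -> line_integral c g = +oo%E).

Definition upper_gradient u g :=
  nonneg_borel g /\ forall c, arclength_curve c -> gradient_ineq u g c.

Definition newtonian u :=
  measurable_fun setT (u : borel X -> \bar R) /\
  (ppower_integral u +
   ereal_inf [set ppower_integral g | g in upper_gradient u] < +oo)%E.

Definition exceptional G :=
  exists rho, [/\ nonneg_borel rho, (ppower_integral rho < +oo)%E &
    forall c, G c -> line_integral c rho = +oo%E].

Definition weak_upper_gradient u g :=
  nonneg_borel g /\ exists2 G, exceptional G &
    forall c, arclength_curve c -> ~ G c -> gradient_ineq u g c.

Definition minimal_weak_upper_gradient u g :=
  [/\ weak_upper_gradient u g, (ppower_integral g < +oo)%E &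
      forall h, weak_upper_gradient u h -> (ppower_integral h < +oo)%E ->
        \forall x \ae mu, (g x <= h x)%E].

Definition average (B : set X) u : \bar R :=
  ((fine (mu B))^-1%:E * \int[mu]_(x in B) u x)%E.

(* g ranges over the versions of the minimal p-weak upper gradient of u, which
   is unique only up to null sets. *)
Definition poincare := exists C lambda : R, [/\ 0 < C, 1 <= lambda &
  forall (x : X) (r : R) u g, 0 < r ->
    newtonian u -> minimal_weak_upper_gradient u g ->
    (average (ball x r) (fun y => `|u y - average (ball x r) u|) <=
     C%:E * diam (ball x r) *
       (average (ball x (lambda * r)) (fun y => g y `^ p)) `^ p^-1)%E].

Definition admissible G rho :=
  nonneg_borel rho /\ forall c, G c -> (1 <= line_integral c rho)%E.

Definition modulus G : \bar R :=
  ereal_inf [set ppower_integral rho | rho in admissible G].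

Definition mod_chain (Omega : set X) (E : nat -> set X) :=
  chain Omega E /\
  forall K : set X, compact K -> K `<=` Omega ->
    modulus (curves_between (E k) K Omega) @[k --> \oo] --> 0%E.

Definition is_mod_end (Omega : set X) (e : set (nat -> set X)) :=
  is_end Omega e /\ exists2 E, e E & mod_chain Omega E.

Definition is_mod_prime_end (Omega : set X) (e : set (nat -> set X)) :=
  is_mod_end Omega e /\
  forall f, is_mod_end Omega f -> end_divides f e -> f = e.

Definition dimension_set (x : X) : set R :=
  [set q | 0 < q /\ exists Cq Rq : R, [/\ 0 < Cq, 0 < Rq &
    forall r s : R, 0 < r -> r <= s -> s <= Rq ->
      fine (mu (ball x r)) / fine (mu (ball x s)) <= Cq * (r / s) `^ q]].

End metric_measure.

(* Main.v *)
Require Import Defs.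
From HB Require Import structures.
From mathcomp Require Import all_boot all_order all_algebra.
From mathcomp Require Import all_classical all_reals all_analysis.
From mathcomp Require Import measurable_realfun ring lra.

Set Implicit Arguments.
Unset Strict Implicit.
Unset Printing Implicit Defensive.

Import Order.TTheory GRing.Theory Num.Theory.
Import numFieldNormedType.Exports.

Local Open Scope classical_set_scope.
Local Open Scope ring_scope.

(* Idea. Applied to z |-> max(0, L - rho_e(a, z)), where rho_e is the infimum of
   the lengths of e-chains, the Poincare inequality and doubling give, by the
   usual telescoping over shrinking balls, that any two points a, b are joined by
   e-chains of length at most K d(a, b), with K independent of e. Refining chains
   over and over and using completeness, one gets curves from a to b within
   distance M d(a, b) of a; in particular X is locally path connected. The
   inequality as stated speaks of minimal p-weak upper gradients, so these must
   first be shown to exist for such functions u: a countable infimum of p-weak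
   upper gradients h_n is again one, because along a curve the Stieltjes measure
   of u(c(t)) + t is dominated by each (h_n(c(t)) + 1) dt.
   If a chain has impression {x}, properness of X (doubling and completeness)
   makes its diameters tend to 0, and concatenating paths in the nested sets
   shows that x is accessible. Conversely, the components of Omega /\ B(x, r/2^k)
   containing the end of a curve that ends at x form a chain with impression {x};
   an end represented by sets shrinking to a point is prime, since otherwise
   these sets would join the boundaries of two consecutive sets of another chain,
   which lie at positive distance. Finally, every curve from the k-th component to
   a fixed compact set crosses many disjoint annuli around x, which makes the
   modulus tend to 0: spread the weight over N annuli if p > 1, and use a
   single small annulus and an exponent q > 1 in Q(x) if p = 1. *)

(** * Stieltjes measures dominated by integrals *)

Section stieltjes.
Context {R : realType}.
Local Notation lebesgue := (@lebesgue_measure R).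
Implicit Types (h : R -> \bar R) (v w : R -> R).

Definition primitive h (t : R) : R := fine (\int[lebesgue]_(x in `]-oo, t]) h x).

Definition density_measure h (_ : measurable_fun setT h)
  (_ : forall t, (0 <= h t)%E) (A : set (measurableTypeR R)) : \bar R :=
  (\int[lebesgue]_(x in A) h x)%E.

Section density.
Variable h : R -> \bar R.
Hypotheses (mh : measurable_fun setT h) (h_ge0 : forall t, (0 <= h t)%E).

Let density0 : density_measure mh h_ge0 set0 = 0%E.
Proof. by rewrite /density_measure integral_set0. Qed.

Let density_ge0 A : (0 <= density_measure mh h_ge0 A)%E.
Proof. by apply: integral_ge0 => t _. Qed.

Let density_sigma_additive : semi_sigma_additive (density_measure mh h_ge0).
Proof. exact: (@semi_sigma_additive_nng_induced _ _ _ lebesgue). Qed.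

HB.instance Definition _ := isMeasure.Build _ _ _ (density_measure mh h_ge0)
  density0 density_ge0 density_sigma_additive.

Hypothesis h_fin : (\int[lebesgue]_x h x < +oo)%E.

Lemma integral_fin_numS (A : set R) : measurable A ->
  (\int[lebesgue]_(x in A) h x)%E \is a fin_num.
Proof.
move=> mA; rewrite ge0_fin_numE; last by apply: integral_ge0 => t _.
apply: le_lt_trans h_fin; apply: ge0_subset_integral => //.
Qed.

Lemma integral_itv_primitive (s t : R) : s <= t ->
  (\int[lebesgue]_(x in `]s, t]) h x)%E = (primitive h t - primitive h s)%:E.
Proof.
move=> st.
have E : (\int[lebesgue]_(x in `]-oo, t]) h x =
    \int[lebesgue]_(x in `]-oo, s]) h x + \int[lebesgue]_(x in `]s, t]) h x)%E.
  rewrite -ge0_integral_setU//=.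
  - by rewrite -itv_bndbnd_setU// ?bnd_simp.
  - by apply: (measurable_funS measurableT).
  - apply/disj_setPS => x /=; rewrite !in_itv/= => -[xs /andP[sx _]].
    by move: (le_lt_trans xs sx); rewrite ltxx.
have Fs := integral_fin_numS (measurable_itv `]-oo, s]).
have Fst := integral_fin_numS (measurable_itv `]s, t]).
by rewrite /primitive E fineD// addrAC subrr add0r fineK.
Qed.

Lemma primitive_nondecreasing : nondecreasing (primitive h).
Proof.
move=> s t st; rewrite -subr_ge0 -lee_fin -integral_itv_primitive//.
by apply: integral_ge0 => x _.
Qed.

(** Absolute continuity of the integral: the increment from [a] to [t] is an integral over a set of
    measure [t - a]. *)
Lemma primitive_right_continuous : right_continuous (primitive h).
Proof.
move=> a.
have ih : lebesgue.-integrable setT h.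
  apply/integrableP; split => //.
  by under eq_integral => x _ do rewrite gee0_abs//.
(* [h] may be infinite on a null set, while absolute continuity is applied to a real-valued
   function; [fine \o h] has the same integrals. *)
have ifh : lebesgue.-integrable setT (EFin \o (fine \o h)).
  apply: le_integrable ih => //.
    by do 2 apply: measurableT_comp => //.
  by move=> x _ /=; case: (h x) => [r||]//=; rewrite ?lexx// normr0 leey.
have [A []] := integrable_ae measurableT ih.
move=> mA A0 /= hA.
have eint (B : set R) : measurable B ->
    (\int[lebesgue]_(x in B) h x = \int[lebesgue]_(x in B) `|(fine (h x))%:E|)%E.
  move=> mB; apply: ge0_ae_eq_integral => //.
  - by apply: (measurable_funS measurableT).
  - apply: (measurable_funS measurableT) => //.
    by do 3 apply: measurableT_comp => //.
  - exists A; split => // x /= /not_implyP[Bx hx]; apply: hA => /= hfin; apply: hx.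
    by rewrite ger0_norm ?fine_ge0// fineK//; exact: hfin.
apply/cvgrPdist_lt => e e0.
have [d [d0 dP]] := integral_normr_continuous ifh e0.
near=> t.
have at_ : a < t by near: t; exact: nbhs_right_gt.
rewrite distrC ger0_norm; last first.
  by rewrite subr_ge0; apply: primitive_nondecreasing; exact: ltW.
have mI := measurable_itv `]a, t].
rewrite (_ : _ - _ = fine (\int[lebesgue]_(x in `]a, t]) h x)); last first.
  by rewrite integral_itv_primitive ?ltW.
rewrite eint//; apply: dP => //.
suff : (lebesgue `]a, t] < d%:E)%E by [].
rewrite lebesgue_measure_itv/= lte_fin at_ -EFinB lte_fin ltrBlDl.
by near: t; apply: nbhs_right_lt; rewrite ltrDl.
Unshelve. all: by end_near.
Qed.

End density.

Lemma lebesgue_stieltjes_measure_oc (f : cumulative R R) (s t : R) : s <= t ->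
  lebesgue_stieltjes_measure f `]s, t] = (f t - f s)%:E.
Proof.
move=> st; rewrite /lebesgue_stieltjes_measure/= /measure_extension/=.
by rewrite measurable_mu_extE//=; [rewrite wlength_itv_bnd|exact: is_ocitv].
Qed.

Lemma ocitv_ordered (P : set R -> Prop) :
  P set0 -> (forall s t, s <= t -> P `]s, t]%classic) -> forall A, ocitv A -> P A.
Proof. by move=> P0 Pst A /ocitvP[->//|[x /ltW x12 ->]]; exact: Pst. Qed.

(* [primitive h - v] is again nondecreasing and right-continuous; its Stieltjes
   measure is the difference of the two sides. *)
Lemma lebesgue_stieltjes_le_integral (v : cumulative R R) h :
  measurable_fun setT h -> (forall t, (0 <= h t)%E) ->
  (\int[lebesgue]_x h x < +oo)%E ->
  (forall s t, s <= t ->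
    ((v t - v s)%:E <= \int[lebesgue]_(x in `]s, t]) h x)%E) ->
  forall A, measurable A ->
    (lebesgue_stieltjes_measure v A <= \int[lebesgue]_(x in A) h x)%E.
Proof.
move=> mh h0 hfin vh A mA.
have rcK := primitive_right_continuous mh h0 hfin.
pose D t := primitive h t - v t.
have ndD : nondecreasing D.
  move=> s t st; rewrite /D -subr_ge0.
  move: (vh _ _ st); rewrite (integral_itv_primitive mh h0 hfin)// lee_fin; lra.
have rcD : right_continuous D.
  by move=> t; apply: cvgB; [exact: rcK|exact: cumulative_is_right_continuous].
pose K := HB.pack_for (cumulative R R) (primitive h) (isCumulative.Build R _ R
  (primitive h) (primitive_nondecreasing mh h0 hfin) rcK).
pose D' := HB.pack_for (cumulative R R) D (isCumulative.Build R _ R D ndD rcD).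
have E1 : lebesgue_stieltjes_measure K A = (\int[lebesgue]_(x in A) h x)%E.
  apply: (lebesgue_stieltjes_measure_unique (mu := density_measure mh h0)) => //.
  apply: ocitv_ordered => [|s t st]; first by rewrite !measure0.
  rewrite lebesgue_stieltjes_measure_oc//; apply/esym.
  exact: integral_itv_primitive.
have -> : (\int[lebesgue]_(x in A) h x =
    lebesgue_stieltjes_measure v A + lebesgue_stieltjes_measure D' A)%E.
  rewrite -E1 -measure_addE; apply: lebesgue_stieltjes_measure_unique => //.
  apply: ocitv_ordered => [|s t st]; first by rewrite !measure0.
  apply/esym; apply: etrans (measure_addE _ _ _) _.
  rewrite lebesgue_stieltjes_measure_oc//=.
  apply: etrans (congr2 adde (lebesgue_stieltjes_measure_oc v st)
                             (lebesgue_stieltjes_measure_oc D' st)) _.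
  have -> : primitive h t - primitive h s = (v t - v s) + (D t - D s) by rewrite /D; lra.
  by [].
exact: leeDl.
Qed.

(** The interval splits into countably many measurable pieces, on the [n]-th of which [H n] exceeds
    the infimum by at most [e]. Domination of the Stieltjes measure on all measurable sets, not only
    on intervals, allows a different [n] on each piece. *)
Lemma cumulative_le_integral_inf (v : cumulative R R) (H : nat -> R -> \bar R) :
  (forall n, measurable_fun setT (H n)) -> (forall n t, (0 <= H n t)%E) ->
  (forall n, (\int[lebesgue]_x H n x < +oo)%E) ->
  (forall n s t, s <= t ->
    ((v t - v s)%:E <= \int[lebesgue]_(x in `]s, t]) H n x)%E) ->
  forall s t, s <= t ->
    ((v t - v s)%:E <=
     \int[lebesgue]_(x in `]s, t]) ereal_inf [set H n x | n in [set: nat]])%E.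
Proof.
move=> mH H0 Hfin vH s t st.
pose G x := ereal_inf [set H n x | n in [set: nat]].
have mG : measurable_fun setT G.
  have -> : G = (fun x => einfs (H ^~ x) 0%N).
    apply/funext => x; rewrite /G /einfs /sdrop; congr ereal_inf.
    by apply/seteqP; split => _ [n _ <-]; exists n.
  exact: measurable_fun_einfs.
have G0 x : (0 <= G x)%E by apply: le_ereal_inf_tmp => _ [n _ <-].
rewrite -lebesgue_stieltjes_measure_oc//.
suff hyp (e : R) : 0 < e -> (lebesgue_stieltjes_measure v `]s, t] <=
    \int[lebesgue]_(x in `]s, t]) G x + (e * (t - s))%:E)%E.
  apply/lee_addgt0Pr => e e0.
  (* The [+ 1] keeps the denominator positive when [s = t]. *)
  have e1 : 0 < e / (t - s + 1) by rewrite divr_gt0//; lra.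
  apply: le_trans (hyp _ e1) _; rewrite leeD2l// lee_fin.
  have d1 : 0 < t - s + 1 by lra.
  by rewrite mulrAC ler_pdivrMr// ler_wpM2l ?ltW//; lra.
move=> e0.
pose B n := `]s, t]%classic `&` [set x | (H n x <= G x + e%:E)%E].
have mB n : measurable (B n).
  apply: measurable_lee => //.
  - exact: measurable_funS (mH n).
  - apply: emeasurable_funD => //.
    exact: measurable_funTS mG.
have cover : `]s, t]%classic = \bigcup_n seqDU B n.
  rewrite -seqDU_bigcup_eq; apply/seteqP; split => [x xst|x [n _ []]//].
  have [Gy|Gfin] := eqVneq (G x) +oo%E.
    by exists 0%N => //; split => //=; rewrite Gy leey.
  have Gf : G x \is a fin_num by rewrite ge0_fin_numE// lt_neqAle Gfin leey.
  have [y [n _ <-] yG] := lb_ereal_inf_adherent e0 Gf.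
  by exists n => //; split => //=; exact: ltW.
have mS n : measurable (seqDU B n) by exact: seqDU_measurable.
rewrite cover measure_bigcup; last 2 first.
- by move=> n _; exact: mS.
- exact: trivIset_seqDU.
apply: (@le_trans _ _ (\sum_(n <oo) \int[lebesgue]_(x in seqDU B n) (G x + e%:E))%E).
  rewrite (eq_eseriesl (Q := xpredT)); last by move=> n; rewrite in_setT.
  apply: lee_nneseries => // n _.
  apply: (@le_trans _ _ (\int[lebesgue]_(x in seqDU B n) H n x)%E).
    exact: (lebesgue_stieltjes_le_integral (mH n) (H0 n) (Hfin n) (vH n) (mS n)).
  apply: ge0_le_integral => //.
  - exact: mS.
  - exact: measurable_funTS (mH n).
  - by apply: emeasurable_funD => //; exact: measurable_funTS mG.
  - by move=> x /(@subset_seqDU _ B n)[_].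
rewrite -ge0_integral_bigcup//; last 2 first.
- by apply: emeasurable_funD => //; exact: measurable_funTS mG.
- by move=> x _; rewrite adde_ge0// lee_fin ltW.
rewrite -cover ge0_integralD//; last 2 first.
- exact: measurable_funTS mG.
- by move=> x _; rewrite lee_fin ltW.
rewrite leeD2l// integral_cst//= lebesgue_measure_itv/= lte_fin.
by case: ifPn => // _; rewrite mule0 lee_fin mulr_ge0//; lra.
Qed.

End stieltjes.

(** * Curves parameterized by arc length *)

Section curves.
Context {R : realType} {X : metricType R}.
Local Notation lebesgue := (@lebesgue_measure R).
Implicit Types (g : R -> X) (rho : X -> \bar R).

Fixpoint polygon_length g (a : R) s : R :=
  if s is x :: s' then mdist (g a) (g x) + polygon_length g x s' else 0.

Lemma polygon_lengthE (b : R) g a s :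
  (let F := g \o nth b (a :: s) in
   \sum_(0 <= n < size s) mdist (F n) (F n.+1)) = polygon_length g a s.
Proof.
elim: s a => [|x s IHs] a /=; first by rewrite big_nil.
by rewrite big_nat_recl//= -IHs.
Qed.

Lemma polygon_length_cat g a s t :
  polygon_length g a (s ++ t) =
  polygon_length g a s + polygon_length g (last a s) t.
Proof.
elim: s a => [|x s IHs] a /=; first by rewrite add0r.
by rewrite IHs addrA.
Qed.

Lemma curve_lengthE (a b : R) g :
  curve_length a b g =
  ereal_sup [set (polygon_length g a s)%:E | s in itv_partition a b].
Proof.
rewrite /curve_length; congr ereal_sup; apply/seteqP.
by split=> _ [s sab <-]; exists s => //=; rewrite -(polygon_lengthE b).
Qed.

Lemma polygon_length_le (a b : R) g s : itv_partition a b s ->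
  ((polygon_length g a s)%:E <= curve_length a b g)%E.
Proof.
by move=> sab; rewrite curve_lengthE; apply: ereal_sup_ubound; exists s.
Qed.

(** Unless [c] is already a node, inserting it replaces one side by two, and the triangle inequality
    applies. *)
Lemma polygon_length_split (a b c : R) g s : a < c -> c < b ->
  itv_partition a b s ->
  polygon_length g a s <= polygon_length g a (itv_partitionL s c) +
                          polygon_length g c (itv_partitionR s c).
Proof.
move=> ac cb [sa _].
have ss : sorted <%O s by exact: path_sorted sa.
have [cs|cs] := boolP (c \in s).
  rewrite {1}(in_itv_partition ss cs) polygon_length_cat.
  by rewrite {2}/itv_partitionL last_rcons.
rewrite {1}(notin_itv_partition ss cs) /itv_partitionL -cats1 !polygon_length_cat.
rewrite -addrA lerD2l /= addr0.
case: (itv_partitionR s c) => [|x r] /=; first by rewrite addr0 mdist_ge0.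
by rewrite addrA lerD2r; exact: metric_triangle.
Qed.

Lemma curve_lengthxx (a : R) g : curve_length a a g = 0%E.
Proof.
rewrite curve_lengthE (_ : [set _ | _ in _] = [set 0%E]) ?ereal_sup1//.
apply/seteqP; split=> [_ [s /itv_partitionxx -> <-]//|_ ->].
by exists [::] => //; split => /=.
Qed.

Lemma curve_length_shift (a l : R) g :
  curve_length 0 l (fun t => g (a + t)) = curve_length a (a + l) g.
Proof.
have E s x : polygon_length (fun t => g (a + t)) x s =
    polygon_length g (a + x) (map (+%R a) s).
  by elim: s x => //= y s IHs x; rewrite IHs.
have P x s : path <%O (a + x) (map (+%R a) s) = path <%O x s.
  by elim: s x => //= y s IHs x; rewrite IHs ltrD2l.
rewrite !curve_lengthE; congr ereal_sup; apply/seteqP; split => _ [s [sp sl] <-].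
  exists (map (+%R a) s); last by rewrite E addr0.
  rewrite -{1}(addr0 a); split; first by rewrite P.
  by rewrite (last_map (+%R a)) (eqP sl).
exists (map (+%R (- a)) s).
  split.
    by rewrite -P addr0 -map_comp (eq_map (g := id)) ?map_id// => y /=; rewrite addrA subrr add0r.
  by rewrite -(addNr a) last_map (eqP sl) addrA addNr add0r.
rewrite E addr0 -map_comp (eq_map (g := id)) ?map_id// => y /=.
by rewrite addrA subrr add0r.
Qed.

Section arclength.
Variable c : R * (R -> X).
Hypothesis arc : arclength_curve c.

(** Additivity of length: partitions of [[0, a]] and [[a, b]] concatenate, which bounds the length
    above, and a partition of [[0, b]] can be split at [a], which bounds it below. *)
Lemma arclength_sub (a b : R) : 0 <= a -> a <= b -> b <= c.1 ->
  curve_length a b c.2 = (b - a)%:E.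
Proof.
case: arc => c0 _ cl a0; rewrite le_eqVlt => /predU1P[<- _|ab bl].
  by rewrite curve_lengthxx subrr.
have b0 := le_lt_trans a0 ab.
have La : curve_length 0 a c.2 = a%:E by apply: cl; rewrite a0/= (le_trans (ltW ab)).
have Lb : curve_length 0 b c.2 = b%:E by apply: cl; rewrite (ltW b0).
apply/eqP; rewrite eq_le; apply/andP; split.
  rewrite curve_lengthE; apply: ge_ereal_sup => _ [s sab <-].
  rewrite lee_fin lerBrDl -lerBrDr -lee_fin -La curve_lengthE.
  apply: ge_ereal_sup => _ [t ta <-].
  rewrite lee_fin lerBrDr -lee_fin -Lb.
  have := polygon_length_le c.2 (itv_partition_cat ta sab).
  by rewrite polygon_length_cat; case: ta => _ /eqP ->.
have [a00|{}a0] : 0 = a \/ 0 < a by apply/predU1P; rewrite -le_eqVlt.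
  by rewrite -a00 subr0 Lb.
rewrite EFinB -Lb leeBlDr// curve_lengthE; apply: ge_ereal_sup => _ [s sb <-].
apply: le_trans (_ : (polygon_length c.2 0 (itv_partitionL s a) +
                      polygon_length c.2 a (itv_partitionR s a))%:E <= _)%E.
  by rewrite lee_fin; exact: polygon_length_split sb.
rewrite addrC EFinD; apply: leeD; first exact/polygon_length_le/itv_partitionRP/sb.
by rewrite -La; exact/polygon_length_le/itv_partitionLP/sb.
Qed.

Lemma arclength_lipschitz (a b : R) : 0 <= a -> a <= b -> b <= c.1 ->
  mdist (c.2 a) (c.2 b) <= b - a.
Proof.
move=> a0; rewrite le_eqVlt => /predU1P[->|ab] bl; first by rewrite mdistxx subrr.
rewrite -lee_fin -(arclength_sub a0 (ltW ab) bl).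
by have := polygon_length_le c.2 (itv_partition1 ab); rewrite /= addr0.
Qed.

Definition clamp (l t : R) := Num.max 0 (Num.min t l).

Lemma clamp_itv (l t : R) : 0 <= l -> 0 <= clamp l t <= l.
Proof. by move=> l0; rewrite /clamp le_max lexx/= ge_max l0/= ge_min lexx orbT. Qed.

Lemma clamp_id (l t : R) : 0 <= t <= l -> clamp l t = t.
Proof. by move=> /andP[t0 tl]; rewrite /clamp min_l// max_r. Qed.

Lemma clamp_nondecreasing (l : R) : {homo clamp l : s t / s <= t}.
Proof.
move=> s t st; rewrite /clamp ge_max le_max lexx/= le_max; apply/orP; right.
by rewrite le_min ge_min st/= ge_min lexx orbT.
Qed.

Lemma clamp_lipschitz (l s t : R) : 0 <= l -> s <= t ->
  clamp l t - clamp l s <= t - s.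
Proof.
move=> l0 st; rewrite /clamp /Order.max /Order.min.
by case: (ltP t l) => ?; case: (ltP s l) => ?; do ?case: ltP => ?; lra.
Qed.

Lemma clamp_itvoc (l s t x : R) : clamp l s < x -> x <= clamp l t -> s < x <= t.
Proof.
rewrite /clamp gt_max => /andP[x0]; rewrite gt_min le_max leNgt x0/= le_min.
by move=> + /andP[-> xl]; rewrite (ltNge l) xl orbF => ->.
Qed.

(** Extending the curve by constants makes it 1-Lipschitz on the whole line, so that composites with
    Borel functions are measurable without restriction to [[0, c.1]]. *)
Definition clamped (t : R) : X := c.2 (clamp c.1 t).

Lemma clamped_id (t : R) : 0 <= t <= c.1 -> clamped t = c.2 t.
Proof. by move=> t0; rewrite /clamped clamp_id. Qed.

Lemma clamped_lipschitz (s t : R) : mdist (clamped s) (clamped t) <= `|s - t|.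
Proof.
wlog st : s t / s <= t.
  move=> H; have [/H//|/ltW/H] := leP s t.
  by rewrite metric_sym distrC.
have c0 : 0 <= c.1 by case: arc => /ltW.
have /andP[s0 _] := clamp_itv s c0; have /andP[_ tl] := clamp_itv t c0.
rewrite distrC ger0_norm ?subr_ge0//.
apply: le_trans (clamp_lipschitz c0 st).
exact: arclength_lipschitz s0 (clamp_nondecreasing _ st) tl.
Qed.

End arclength.

Lemma continuous_mdistP g : continuous g <->
  forall t e, 0 < e ->
    exists2 d, 0 < d & forall s, `|t - s| < d -> mdist (g t) (g s) < e.
Proof.
split=> [cg t e e0|H t].
  have /metricType_numDomainType.cvgrPdist_lt/(_ _ e0) := cg t.
  by move=> /nbhs_ballP[d /= d0 hd]; exists d.
apply/metricType_numDomainType.cvgrPdist_lt => e /H-/(_ t)[d d0 hd].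
by apply/nbhs_ballP; exists d.
Qed.

Lemma within_continuous_mdistP (A : set R) g : {within A, continuous g} <->
  forall t e, A t -> 0 < e ->
    exists2 d, 0 < d & forall s, A s -> `|t - s| < d -> mdist (g t) (g s) < e.
Proof.
rewrite subspace_continuousP; split=> [cg t e At e0|H t At].
  have /metricType_numDomainType.cvgrPdist_lt/(_ _ e0) := cg t At.
  by move=> /nbhs_ballP[d /= d0 hd]; exists d => // s As ts; exact: hd.
apply/metricType_numDomainType.cvgrPdist_lt => e /(H t _ At)[d d0 hd].
by apply/nbhs_ballP; exists d => // s ts As; exact: hd.
Qed.

Lemma lipschitz_continuous g :
  (forall s t, mdist (g s) (g t) <= `|s - t|) -> continuous g.
Proof.
move=> lg; apply/continuous_mdistP => t e e0; exists e => // s ts.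
exact: le_lt_trans (lg _ _) ts.
Qed.

Lemma subcurve_arclength (c : R * (R -> X)) (a b : R) : arclength_curve c ->
  0 <= a -> a < b -> b <= c.1 ->
  arclength_curve (b - a, fun t => c.2 (a + t)).
Proof.
move=> arc a0 ab bl; split => /=; first by rewrite subr_gt0.
  apply/within_continuous_mdistP => t e /=; rewrite in_itv/= => /andP[t0 tb] e0.
  exists e => // s; rewrite /= in_itv/= => /andP[s0 sb] ts.
  apply: le_lt_trans ts; have [st|/ltW ts] := leP s t.
    rewrite metric_sym ger0_norm ?subr_ge0//.
    by apply: le_trans (arclength_lipschitz arc _ _ _) _; lra.
  rewrite distrC ger0_norm ?subr_ge0//.
  by apply: le_trans (arclength_lipschitz arc _ _ _) _; lra.
move=> t /andP[t0 tb].
have at_ : a <= a + t by lra.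
have tl : a + t <= c.1 by lra.
by rewrite (curve_length_shift a t c.2) (arclength_sub arc a0 at_ tl) addrC addKr.
Qed.

End curves.

(** * Line integrals and countable infima of integrands *)

Section line_integrals.
Context {R : realType} {X : completeMetricType R}.
Local Notation lebesgue := (@lebesgue_measure R).

Lemma lebesgue_measure_shift (a : R) (A : set R) : measurable A ->
  pushforward lebesgue (+%R a : _ -> measurableTypeR R) A = lebesgue A.
Proof.
move=> mA; apply/esym/lebesgue_measure_unique => //=.
  by apply: measurable_funD.
move=> _ _ [[x y] _ <-] /=.
rewrite /pushforward (_ : _ @^-1` _ = `]x - a, y - a]%classic); last first.
  apply/seteqP; split => t /=; rewrite !in_itv/= => /andP[? ?]; apply/andP; split; lra.
rewrite !lebesgue_measure_itv/= !lte_fin ltrD2r -!EFinB; case: ifP => // _.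
by congr EFin; lra.
Qed.

Lemma ge0_integral_shift (a l : R) (F : R -> \bar R) :
  measurable_fun setT F -> (forall t, (0 <= F t)%E) ->
  (\int[lebesgue]_(t in `[0%R, l]) F (a + t)%R =
   \int[lebesgue]_(t in `[a, (a + l)%R]) F t)%E.
Proof.
move=> mF F0.
rewrite (_ : `[0, l]%classic =
    (+%R a : _ -> measurableTypeR R) @^-1` `[a, a + l]); last first.
  by apply/seteqP; split => t /=; rewrite !in_itv/= => /andP[? ?]; apply/andP; split; lra.
have ma : measurable_fun setT (+%R a : _ -> measurableTypeR R).
  exact: measurable_funD.
transitivity (\int[lebesgue]_(t in (+%R a : _ -> measurableTypeR R) @^-1`
    `[a, (a + l)%R]) (F \o (+%R a : _ -> measurableTypeR R)) t)%E => //.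
rewrite -ge0_integral_pushforward//=.
- by apply: eq_measure_integral => //= A mA AS; exact/lebesgue_measure_shift.
- exact: measurable_funTS mF.
Qed.

Lemma continuous_borel (g : R -> X) : continuous g ->
  measurable_fun setT (g : R -> borel X).
Proof.
move=> /continuousP cg; apply: (@measurability _ _ _ (borel X) setT g (@open X) erefl).
move=> _ [B oB <-]; rewrite setTI.
by apply: open_measurable; exact: cg.
Qed.

Lemma nonneg_borel_inf (h : nat -> X -> \bar R) :
  (forall n, nonneg_borel (h n)) ->
  nonneg_borel (fun x => ereal_inf [set h n x | n in [set: nat]]).
Proof.
move=> hb; split; last first.
  by move=> x; apply: le_ereal_inf_tmp => _ [n _ <-]; case: (hb n).
rewrite (_ : (fun x => _) = (fun x => einfs (h ^~ x) 0%N)).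
  by apply: measurable_fun_einfs => n; case: (hb n).
apply/funext => x; rewrite /einfs /sdrop; congr ereal_inf.
by apply/seteqP; split => _ [n _ <-]; exists n.
Qed.

Section along_a_curve.
Variables (c : R * (R -> X)) (rho : X -> \bar R).
Hypotheses (arc : arclength_curve c) (rho_borel : nonneg_borel rho).

Lemma measurable_comp_clamped :
  measurable_fun setT (fun t => rho (clamped c t)).
Proof.
case: rho_borel => mrho _; apply: (measurableT_comp mrho).
exact: (continuous_borel (lipschitz_continuous (clamped_lipschitz arc))).
Qed.

Lemma line_integral_clamped : line_integral c rho =
  (\int[lebesgue]_(t in `[0%R, c.1]) rho (clamped c t))%E.
Proof.
apply: eq_integral => t; rewrite inE/= in_itv/= => t0.
by rewrite clamped_id.
Qed.

Lemma line_integral_subcurve (a b : R) : 0 <= a -> a < b -> b <= c.1 ->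
  line_integral (b - a, fun t => c.2 (a + t)) rho =
  (\int[lebesgue]_(t in `[a, b]) rho (clamped c t))%E.
Proof.
move=> a0 ab bl; rewrite /line_integral/=.
rewrite -[X in `[a, X]](subrKC a b).
rewrite -(@ge0_integral_shift _ _ (fun t => rho (clamped c t))); last 2 first.
- exact: measurable_comp_clamped.
- by move=> t; case: rho_borel.
apply: eq_integral => t; rewrite inE/= in_itv/= => /andP[t0 tl].
by rewrite clamped_id//; apply/andP; split; lra.
Qed.

Lemma line_integral_subcurve_le (a b : R) : 0 <= a -> a < b -> b <= c.1 ->
  (line_integral ((b - a)%R, fun t => c.2 (a + t)%R) rho <= line_integral c rho)%E.
Proof.
move=> a0 ab bl; rewrite line_integral_subcurve// line_integral_clamped.
apply: ge0_subset_integral => //.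
- exact: measurable_funTS measurable_comp_clamped.
- by move=> t _; case: rho_borel.
- by move=> t /=; rewrite !in_itv/= => /andP[? ?]; apply/andP; split; lra.
Qed.

End along_a_curve.

(* Adding arc length to [f] along the curve makes it nondecreasing, hence the
   distribution function of a Stieltjes measure. *)
Lemma line_integral_inf (c : R * (R -> X)) (f : X -> R) (h : nat -> X -> \bar R) :
  arclength_curve c ->
  (forall s t, `|f (clamped c s) - f (clamped c t)| <= `|s - t|) ->
  (forall n, nonneg_borel (h n)) ->
  (forall n, (line_integral c (h n) < +oo)%E) ->
  (forall n a b, 0 <= a -> a < b -> b <= c.1 ->
     ((f (c.2 b) - f (c.2 a))%:E <=
      line_integral ((b - a)%R, fun t => c.2 (a + t)%R) (h n))%E) ->
  ((f (c.2 c.1) - f (c.2 0))%:E <=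
   line_integral c (fun x => ereal_inf [set h n x | n in [set: nat]]))%E.
Proof.
move=> arc lipf hb hfin hsub.
have c0 : 0 < c.1 by case: arc.
have c0' := ltW c0.
pose I : set R := `[0, c.1]%classic.
have mI : measurable I by exact: measurable_itv.
(* The constant 1 is the density of the arc length added to [f]. *)
pose H n : R -> \bar R := (fun t => (h n (clamped c t) + 1)%E) \_ I.
have mh n : measurable_fun setT (fun t => (h n (clamped c t) + 1)%E).
  by apply: emeasurable_funD => //; exact: measurable_comp_clamped.
have h0 n t : (0 <= h n (clamped c t) + 1)%E.
  by rewrite adde_ge0//; case: (hb n).
have mH n : measurable_fun setT (H n).
  by apply/(measurable_restrictT _ mI); exact: measurable_funTS.
have H0 n t : (0 <= H n t)%E by rewrite /H patchE; case: ifP.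
have intH n (A : set R) : measurable A ->
    (\int[lebesgue]_(t in A) H n t =
     \int[lebesgue]_(t in A `&` I) h n (clamped c t) + lebesgue (A `&` I))%E.
  move=> mA; rewrite -integral_mkcondr ge0_integralD//.
  - by rewrite integral_cst ?mul1e//; exact: measurableI.
  - exact: measurableI.
  - by move=> t _; case: (hb n).
  - by apply: measurable_funTS; exact: measurable_comp_clamped.
have Hfin n : (\int[lebesgue]_t H n t < +oo)%E.
  rewrite intH// setTI -(line_integral_clamped c (h n)) lte_add_pinfty ?hfin//.
  by rewrite lebesgue_measure_itv/= lte_fin c0 -EFinB ltry.
pose v t := f (clamped c t) + clamp c.1 t.
have clI t : 0 <= clamp c.1 t <= c.1 by exact: clamp_itv.
have cl2 t : clamp c.1 (clamp c.1 t) = clamp c.1 t by apply: clamp_id.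
have vE t : v t = v (clamp c.1 t) by rewrite /v /clamped !cl2.
have ndv : nondecreasing v.
  move=> s t st; rewrite vE [leRHS]vE.
  have := clamp_nondecreasing c.1 st.
  move: (clamp _ s) (clamp _ t) (clI s) (clI t) => a b aI bI ab.
  rewrite /v !clamp_id//.
  by have := lipf a b; rewrite (distrC a) (ger0_norm (_ : 0 <= b - a)) ?ler_norml; lra.
have rcv : right_continuous v.
  apply: right_continuousW => t; apply/cvgrPdist_lt => e e0.
  near=> s.
  apply: (@le_lt_trans _ _ (2 * `|t - s|)); last first.
    rewrite -ltr_pdivlMl//; near: s; apply: (@cvgr_dist_lt _ R^o) => //.
    by rewrite mulr_gt0.
  rewrite /v opprD addrACA mulr_natl mulr2n.
  rewrite (le_trans (ler_normD _ _))// lerD//.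
  have [st|/ltW st] := leP s t.
    rewrite !ger0_norm ?subr_ge0//; first exact: clamp_lipschitz.
    exact: clamp_nondecreasing.
  rewrite distrC (distrC t) !ger0_norm ?subr_ge0//; first exact: clamp_lipschitz.
  exact: clamp_nondecreasing.
pose v' := HB.pack_for (cumulative R R) v (isCumulative.Build R _ R v ndv rcv).
have vH n s t : s <= t ->
    ((v' t - v' s)%:E <= \int[lebesgue]_(x in `]s, t]) H n x)%E.
  move=> st /=.
  (* [v] is constant on either side of [[0, c.1]], so the increment is taken between the clamped end
     points. *)
  rewrite vE (vE s); have := clamp_nondecreasing c.1 st.
  have [ab _|ba ab] := ltP (clamp c.1 s) (clamp c.1 t); last first.
    have -> : clamp c.1 s = clamp c.1 t by apply/eqP; rewrite eq_le ba ab.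
    by rewrite subrr; exact: integral_ge0.
  have sub : `]clamp c.1 s, clamp c.1 t]%classic `<=` `]s, t]%classic.
    move=> x /=; rewrite !in_itv/= => /andP[sx xt].
    exact: clamp_itvoc sx xt.
  apply: (@le_trans _ _ (\int[lebesgue]_(x in `]clamp c.1 s, clamp c.1 t])
    H n x)%E); last first.
    by apply: ge0_subset_integral => //; apply: measurable_funTS (mH n).
  move: {sub} (clamp _ s) (clamp _ t) (clI s) (clI t) ab => a b aI bI ab.
  have sub : `]a, b]%classic `<=` I.
    by rewrite /I => x /=; rewrite !in_itv/= => /andP[? ?]; apply/andP; split; lra.
  rewrite intH// (setIidl sub) lebesgue_measure_itv/= lte_fin ab -EFinB.
  rewrite /v !clamp_id// opprD addrACA [leLHS]EFinD; apply: leeD => //.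
  rewrite !clamped_id//.
  have a0 : 0 <= a by lra.
  have bc : b <= c.1 by lra.
  apply: le_trans (hsub n _ _ a0 ab bc) _.
  rewrite line_integral_subcurve// integral_itv_obnd_cbnd//.
  by apply: measurable_funTS; exact: measurable_comp_clamped.
pose G x := ereal_inf [set h n x | n in [set: nat]].
have bG : nonneg_borel G by exact: nonneg_borel_inf.
have mG := measurable_comp_clamped arc bG.
(* Both sides receive the arc length [c.1], which is the contribution of the constant 1 in [H n]. *)
rewrite -(@leeD2rE _ c.1%:E)// -EFinD.
have := cumulative_le_integral_inf mH H0 Hfin vH c0'.
rewrite /= /v clamp_id ?c0'/= ?lexx// clamp_id ?c0'/= ?lexx//.
rewrite !clamped_id ?c0' ?lexx//= addr0 addrAC => /le_trans; apply.
rewrite line_integral_clamped -/G -integral_itv_obnd_cbnd; last first.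
  exact: measurable_funTS mG.
apply: (@le_trans _ _ (\int[lebesgue]_(t in `]0%R, c.1]) (G (clamped c t) + 1))%E).
  apply: ge0_le_integral => //.
  - by move=> t _; apply: le_ereal_inf_tmp => _ [n _ <-].
  - apply: measurable_funTS.
    rewrite (_ : (fun x => _) = (fun x => einfs (H ^~ x) 0%N)).
      by apply: measurable_fun_einfs.
    apply/funext => x; rewrite /einfs /sdrop; congr ereal_inf.
    by apply/seteqP; split => _ [n _ <-]; exists n.
  - by apply: emeasurable_funD => //; exact: measurable_funTS mG.
  move=> t /=; rewrite in_itv/= => /andP[t0 tl].
  rewrite -leeBlDr//; apply: le_ereal_inf_tmp => _ [n _ <-].
  rewrite leeBlDr//; apply: ge_ereal_inf; exists (H n t); first by exists n.
  by rewrite /H patchE mem_set// /I/= in_itv/= (ltW t0).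
rewrite ge0_integralD//.
- rewrite integral_cst//= mul1e lebesgue_measure_itv/= lte_fin c0 -EFinB subr0.
  by [].
- by move=> t _; case: bG.
- exact: measurable_funTS mG.
Unshelve. all: by end_near.
Qed.

End line_integrals.

(** * Minimal weak upper gradients *)

(** The difference [G - F] is nonnegative where [F] is finite, hence almost everywhere, and its
    integral is zero. *)
Lemma ae_eq_of_le_integral d (T : measurableType d) (R : realType)
    (mu : {measure set T -> \bar R}) (F G : T -> \bar R) :
  measurable_fun setT F -> measurable_fun setT G ->
  (forall x, 0 <= F x)%E -> (forall x, F x <= G x)%E ->
  (\int[mu]_x G x < +oo)%E -> (\int[mu]_x G x <= \int[mu]_x F x)%E ->
  \forall x \ae mu, F x = G x.
Proof.
move=> mF mG F0 FG Gfin GF.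
have G0 x : (0 <= G x)%E by exact: le_trans (F0 x) (FG x).
have iG : mu.-integrable setT G.
  by apply/integrableP; split => //; under eq_integral => x _ do rewrite gee0_abs//.
have iF : mu.-integrable setT F.
  by apply: (le_integrable measurableT mF _ iG) => x _; rewrite !gee0_abs//.
have D0 x : F x \is a fin_num -> (0 <= G x - F x)%E.
  by move=> Fx; rewrite sube_ge0 ?Fx//; exact: FG.
have := integrable_ae measurableT iF.
have := integrable_ae measurableT iG.
have : ae_eq mu setT (fun x => G x - F x)%E (cst 0%E).
  apply/(ae_eq_integral_abs mu measurableT).
    by apply: emeasurable_funB.
  have intFfin : (\int[mu]_x F x)%E \is a fin_num by exact: integrable_fin_num.
  have E : (\int[mu]_x F x = \int[mu]_x G x)%E.
    by apply/eqP; rewrite eq_le GF andbT; exact: ge0_le_integral.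
  transitivity (\int[mu]_x (G x - F x))%E; last first.
    by rewrite (integralB measurableT iG iF) -E subee.
  apply: ae_eq_integral => //.
  - by apply: measurableT_comp => //; exact: emeasurable_funB.
  - exact: emeasurable_funB.
  apply: filterS (integrable_ae measurableT iF) => x /(_ Logic.I) Ffin _.
  by rewrite gee0_abs// D0.
apply: filterS3 => x /(_ Logic.I)/= + /(_ Logic.I) Gx /(_ Logic.I) Fx.
by move=> /eqP; rewrite sube_eq ?add0e ?fin_num_adde_defl// => /eqP.
Qed.

Lemma le_poweR (R : realType) (x y : \bar R) (r : R) :
  0 <= r -> (0 <= x)%E -> (x <= y)%E -> (x `^ r <= y `^ r)%E.
Proof.
move=> r0 x0 xy; apply: gt0_ler_poweR => //; rewrite in_itv/= leey andbT//.
exact: le_trans xy.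
Qed.

Section weak_upper_gradients.
Context {R : realType} {X : completeMetricType R}.
Variables (mu : {measure set (borel X) -> \bar R}) (p : R).
Hypothesis p_gt0 : 0 < p.
Local Notation lebesgue := (@lebesgue_measure R).

Lemma ppower_integralE (g : X -> \bar R) : (forall x, 0 <= g x)%E ->
  ppower_integral mu p g = (\int[mu]_x (g x `^ p))%E.
Proof. by move=> g0; apply: eq_integral => x _; rewrite gee0_abs. Qed.

Lemma measurable_ppower (g : X -> \bar R) : nonneg_borel g ->
  measurable_fun setT ((fun x => (g x `^ p)%E) : borel X -> \bar R).
Proof.
by case=> mg _; exact: (measurableT_comp (measurable_poweR p) mg).
Qed.

Lemma le_ppower_integral (g h : X -> \bar R) :
  nonneg_borel g -> nonneg_borel h -> (forall x, g x <= h x)%E ->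
  (ppower_integral mu p g <= ppower_integral mu p h)%E.
Proof.
move=> bg bh gh; rewrite !ppower_integralE; [|by case: bh|by case: bg].
apply: ge0_le_integral => //.
- by move=> x _; exact: poweR_ge0.
- exact: measurable_ppower.
- exact: measurable_ppower.
- by move=> x _; apply: le_poweR => //; [exact: ltW|case: bg].
Qed.

Lemma line_integral_ge (c : R * (R -> X)) (g h : X -> \bar R) (k : R) :
  arclength_curve c -> nonneg_borel g -> nonneg_borel h -> 0 <= k ->
  (forall x, k%:E * g x <= h x)%E ->
  (k%:E * line_integral c g <= line_integral c h)%E.
Proof.
move=> arc bg bh k0 gh; rewrite !line_integral_clamped.
have mg := measurable_comp_clamped arc bg.
rewrite -ge0_integralZl//.
- apply: ge0_le_integral => //.
  + by move=> t _; rewrite mule_ge0//; case: bg.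
  + by apply: measurable_funeM; exact: measurable_funTS mg.
  + exact: measurable_funTS (measurable_comp_clamped arc bh).
- exact: measurable_funTS mg.
- by move=> t _; case: bg.
Qed.

(* [rho = (\sum_n a_n rho_n ^ p) ^ (1/p)] dominates a multiple of every [rho_n]. *)
Lemma exceptional_bigcup (G : nat -> set (R * (R -> X))) :
  (forall n, exceptional mu p (G n)) ->
  exceptional mu p [set c | arclength_curve c /\ exists n, G n c].
Proof.
move=> /choice[rho hrho].
have brho n : nonneg_borel (rho n) by case: (hrho n).
have rho0 n x : (0 <= rho n x)%E by case: (brho n).
pose e n := fine (ppower_integral mu p (rho n)).
have e0 n : 0 <= e n by apply: fine_ge0; apply: integral_ge0 => x _; exact: poweR_ge0.
have eE n : (\int[mu]_x (rho n x `^ p) = (e n)%:E)%E.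
  rewrite -ppower_integralE// fineK// ge0_fin_numE; first by case: (hrho n).
  by apply: integral_ge0 => x _; exact: poweR_ge0.
(* With this weight the [n]-th term of the series has integral at most [1 / 2 ^ n.+1]; the [1 +]
   avoids a division by zero. *)
pose a n : R := (1 / (2 ^ n.+1)%:R) / (1 + e n).
have a0 n : 0 < a n.
  by rewrite /a !divr_gt0// ?ltr0n ?expn_gt0// ltr_pwDl.
pose F x := (\sum_(n <oo) (a n)%:E * rho n x `^ p)%E.
have aF0 n x : (0 <= (a n)%:E * rho n x `^ p)%E.
  by rewrite mule_ge0// ?poweR_ge0// lee_fin ltW.
have F0 x : (0 <= F x)%E by apply: nneseries_ge0.
have maF n : measurable_fun setT
    ((fun x => (a n)%:E * rho n x `^ p)%E : borel X -> \bar R).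
  by apply: measurable_funeM; exact: measurable_ppower.
have mF : measurable_fun setT (F : borel X -> \bar R).
  by apply: (ge0_emeasurable_sum (P := xpredT)) => // n; exact: maF.
have bF : nonneg_borel (fun x => F x `^ p^-1)%E.
  split; last by move=> x; exact: poweR_ge0.
  exact: (measurableT_comp (measurable_poweR p^-1) mF).
exists (fun x => F x `^ p^-1)%E; split => //.
  rewrite ppower_integralE; last by move=> x; exact: poweR_ge0.
  under eq_integral => x _ do rewrite -poweRrM mulVf ?gt_eqF// poweRe1//.
  rewrite integral_nneseries//.
  apply: le_lt_trans (_ : (1%:E < +oo)%E); last by rewrite ltry.
  apply: le_trans (epsilon_trick0 xpredT (@ler01 R)).
  apply: lee_nneseries => n _.
    by move=> _; apply: integral_ge0.
  rewrite ge0_integralZl//; last 3 first.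
  - exact: measurable_ppower.
  - by move=> x _; exact: poweR_ge0.
  - by rewrite lee_fin ltW.
  rewrite eE -EFinM lee_fin /a mulrAC ler_pdivrMr ?ltr_pwDl//.
  by rewrite ler_wpM2l// lerDr.
move=> c [arc [n Gc]].
have := @line_integral_ge c (rho n) _ (a n `^ p^-1) arc (brho n) bF (powR_ge0 _ _).
case: (hrho n) => _ _ /(_ _ Gc) ->; rewrite gt0_muley ?lte_fin ?powR_gt0//.
move=> H; apply/eqP; rewrite -leye_eq; apply: H => x.
have -> : ((a n `^ p^-1)%:E * rho n x = ((a n)%:E * rho n x `^ p) `^ p^-1)%E.
  rewrite poweRM ?poweR_ge0 ?lee_fin ?(ltW (a0 n))//.
  by rewrite -poweRrM mulfV ?gt_eqF// poweRe1.
apply: le_poweR => //; first by rewrite invr_ge0 ltW.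
apply: le_trans (nneseries_lim_ge n.+1 _) => //.
by rewrite big_nat_recr//= leeDr// sume_ge0.
Qed.

Lemma exceptional_setU (G H : set (R * (R -> X))) :
  exceptional mu p G -> exceptional mu p H ->
  exceptional mu p [set c | arclength_curve c /\ (G c \/ H c)].
Proof.
move=> eG eH.
have [rho [brho rhofin hrho]] := @exceptional_bigcup
  (fun n => if n is 0%N then G else H) (fun n => if n is 0%N then eG else eH).
exists rho; split => // c [arc [Gc|Hc]]; apply: hrho; split => //.
  by exists 0%N.
by exists 1%N.
Qed.

(** The same [rho] serves, as its integral along a curve is at least that along any subcurve. *)
Lemma exceptional_subcurve (G : set (R * (R -> X))) : exceptional mu p G ->
  exceptional mu p [set c | arclength_curve c /\ exists a b,
    [/\ 0 <= a, a < b, b <= c.1 & G (b - a, fun t => c.2 (a + t))]].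
Proof.
move=> [rho [brho rhofin hrho]]; exists rho; split => //.
move=> c [arc [a [b [a0 ab bc /hrho Gc]]]].
apply/eqP; rewrite -leye_eq -Gc; exact: line_integral_subcurve_le.
Qed.

Section lipschitz_along_curves.
Variable f : X -> R.
Hypothesis lip_f : forall c, arclength_curve c ->
  forall s t, `|f (clamped c s) - f (clamped c t)| <= `|s - t|.

(** Exceptional are the curves along which some [h n] has infinite integral, and those with a
    subcurve exceptional for some [h n]. Subcurves count because [line_integral_inf] needs the
    gradient inequality over every subinterval. *)
Lemma weak_upper_gradient_inf (h : nat -> X -> \bar R) :
  (forall n, weak_upper_gradient mu p (EFin \o f) (h n)) ->
  (forall n, ppower_integral mu p (h n) < +oo)%E ->
  weak_upper_gradient mu p (EFin \o f)
    (fun x => ereal_inf [set h n x | n in [set: nat]]).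
Proof.
move=> wh hfin.
have bh n : nonneg_borel (h n) by case: (wh n).
split; first exact: nonneg_borel_inf.
have /choice[G hG] : forall n, exists G, exceptional mu p G /\ forall c,
    arclength_curve c -> ~ G c -> gradient_ineq (EFin \o f) (h n) c.
  by move=> n; case: (wh n) => _ [G ? ?]; exists G.
have einf n : exceptional mu p [set c | line_integral c (h n) = +oo%E].
  by exists (h n); split.
have eG n : exceptional mu p (G n) by case: (hG n).
exists [set c | arclength_curve c /\ exists n, arclength_curve c /\
    ((arclength_curve c /\ exists a b,
    [/\ 0 <= a, a < b, b <= c.1 & G n (b - a, fun t => c.2 (a + t))]) \/
    line_integral c (h n) = +oo%E)].
  apply: exceptional_bigcup => n; apply: exceptional_setU; last exact: einf.
  exact: exceptional_subcurve.
move=> c arc Gc.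
have hfin' n : (line_integral c (h n) < +oo)%E.
  rewrite ltey; apply/eqP => hoo; apply: Gc; split=> //; exists n; split=> //.
  by right.
have grad n a b : 0 <= a -> a < b -> b <= c.1 ->
    (`|f (c.2 a) - f (c.2 b)|%:E <=
     line_integral ((b - a)%R, fun t => c.2 (a + t)%R) (h n))%E.
  move=> a0 ab bc; case: (hG n) => _ /(_ (b - a, fun t => c.2 (a + t))).
  move=> /(_ (subcurve_arclength arc a0 ab bc)) H.
  have /H[+ _] : ~ G n (b - a, fun t => c.2 (a + t)).
    move=> Gn; apply: Gc; split => //; exists n; split => //; left; split => //.
    by exists a, b.
  by rewrite /= addr0 subrKC; apply.
split=> [_|[]//] /=.
(* [line_integral_inf] bounds a signed increment, so it is applied to [f] or to [- f]. *)
have [le0|gt0] := lerP (f (c.2 0) - f (c.2 c.1)) 0.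
  rewrite ler0_norm// opprB.
  apply: (@line_integral_inf _ _ c f h arc (lip_f arc) bh hfin') => n a b a0 ab bc.
  apply: le_trans (grad n _ _ a0 ab bc); rewrite lee_fin distrC.
  exact: ler_norm.
rewrite gtr0_norm// -[f (c.2 0)]opprK [- - _ - _]addrC.
apply: (@line_integral_inf _ _ c (fun x => - f x) h arc _ bh hfin').
  by move=> s t; rewrite opprK addrC distrC; exact: lip_f.
move=> n a b a0 ab bc.
apply: le_trans (grad n _ _ a0 ab bc); rewrite lee_fin opprK addrC.
exact: ler_norm.
Qed.

(** The infimum [g] of a sequence minimizing the integral of the [p]-th power is again a weak upper
    gradient and attains the minimum. For any competitor [h'], the minimum of [g] and [h'] has no
    smaller integral than [g], hence equals [g] almost everywhere. *)
Lemma minimal_weak_upper_gradient_exists (h : X -> \bar R) :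
  weak_upper_gradient mu p (EFin \o f) h -> (ppower_integral mu p h < +oo)%E ->
  exists g, minimal_weak_upper_gradient mu p (EFin \o f) g.
Proof.
move=> wh hfin.
pose D := [set h | weak_upper_gradient mu p (EFin \o f) h /\
                   (ppower_integral mu p h < +oo)%E].
pose m := ereal_inf [set ppower_integral mu p h | h in D].
have m0 : (0 <= m)%E.
  apply: le_ereal_inf_tmp => _ [h' _ <-].
  by apply: integral_ge0 => x _; exact: poweR_ge0.
have mfin : m \is a fin_num.
  rewrite ge0_fin_numE//; apply: (le_lt_trans _ hfin).
  apply: ge_ereal_inf; exists (ppower_integral mu p h) => //.
  by exists h => //; split.
have Dinf (k : nat -> X -> \bar R) n : (forall n, D (k n)) ->
    D (fun x => ereal_inf [set k n x | n in [set: nat]]) /\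
    (ppower_integral mu p (fun x => ereal_inf [set k n x | n in [set: nat]]) <=
     ppower_integral mu p (k n))%E.
  move=> Dk; have bk n' : nonneg_borel (k n') by case: (Dk n') => -[].
  have le n' : (ppower_integral mu p (fun x => ereal_inf [set k n x | n in [set: nat]])
       <= ppower_integral mu p (k n'))%E.
    apply: le_ppower_integral => //; first exact: nonneg_borel_inf.
    by move=> x; apply: ge_ereal_inf; exists (k n' x) => //; exists n'.
  split => //; split.
    by apply: weak_upper_gradient_inf => n'; case: (Dk n').
  by apply: le_lt_trans (le 0%N) _; case: (Dk 0%N).
have /choice[k hk] : forall n, exists k, D k /\
    (ppower_integral mu p k <= m + (n.+1%:R^-1)%:E)%E.
  have posinv n : 0 < n.+1%:R^-1 :> R by rewrite invr_gt0 ltr0n.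
  move=> n; have [_ [k Dk <-] /ltW km] := @lb_ereal_inf_adherent _ _ (n.+1%:R^-1)
    (posinv n) mfin.
  by exists k.
have Dk n : D (k n) by case: (hk n).
pose g x := ereal_inf [set k n x | n in [set: nat]].
have [Dg _] := Dinf k 0%N Dk.
have gm : (ppower_integral mu p g <= m)%E.
  apply/lee_addgt0Pr => e e0; have [n en] := ltr_add_invr e0.
  rewrite add0r in en.
  have [_ le] := Dinf k n Dk; apply: le_trans le _.
  by case: (hk n) => _ /le_trans; apply; rewrite leeD2l// lee_fin ltW.
exists g; case: (Dg) => wg gfin; split => // h' wh' h'fin.
(* The pair [g], [h'] is written as a sequence so that [Dinf] applies. *)
pose k' n : X -> \bar R := if n is 0%N then g else h'.
have Dk' n : D (k' n) by case: n.
pose g' x := ereal_inf [set k' n x | n in [set: nat]].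
have [Dg' le'] := Dinf k' 0%N Dk'.
have bg : nonneg_borel g by case: wg.
have bg' : nonneg_borel g' by case: Dg' => -[].
have mg' : (m <= ppower_integral mu p g')%E.
  by apply: ge_ereal_inf; exists (ppower_integral mu p g') => //; exists g'.
have g'g x : (g' x <= g x)%E by apply: ge_ereal_inf; exists (g x) => //; exists 0%N.
have g0 x : (0 <= g x)%E by case: bg.
have g'0 x : (0 <= g' x)%E by case: bg'.
have : \forall x \ae mu, (g' x `^ p = g x `^ p)%E.
  apply: ae_eq_of_le_integral.
  - exact: measurable_ppower.
  - exact: measurable_ppower.
  - by move=> x; exact: poweR_ge0.
  - by move=> x; apply: le_poweR => //; exact: ltW.
  - by rewrite -ppower_integralE.
  - by rewrite -!ppower_integralE//; exact: le_trans gm mg'.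
move=> [N [mN N0 hN]]; exists N; split => // x /= ngh; apply: hN => /= E.
apply: ngh; have <- : g' x = g x.
  by rewrite -[LHS]poweRe1// -[RHS]poweRe1// -(divff (lt0r_neq0 p_gt0)) !poweRrM E.
by apply: ge_ereal_inf; exists (h' x) => //; exists 1%N.
Qed.

End lipschitz_along_curves.
End weak_upper_gradients.

(** * Consequences of the Poincare inequality *)

Section averages.
Context {R : realType} {X : completeMetricType R}.
Variable mu : {measure set (borel X) -> \bar R}.
Implicit Types (A B : set X) (f : X -> R).

Lemma measurable_ball (a : X) (r : R) : measurable (ball a r : set (borel X)).
Proof.
apply: sub_sigma_algebra; rewrite openE => y; rewrite /= ballEmdist /= => ay.
apply/nbhs_ballP; exists (r - mdist a y); first by rewrite /= subr_gt0.
move=> z; rewrite !ballEmdist /= => yz.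
by apply: le_lt_trans (metric_triangle a y z) _; rewrite -ltrBrDl.
Qed.

Definition mean A f : R := (fine (mu A))^-1 * Rintegral mu (A : set (borel X)) f.

Definition bounded_borel f :=
  measurable_fun setT (f : borel X -> R) /\ exists M, forall x, `|f x| <= M.

Section mean.
Variables (A : set X).
Hypotheses (mA : measurable (A : set (borel X))) (A0 : (0 < mu A < +oo)%E).

Let finA : 0 < fine (mu A).
Proof. exact: fine_gt0. Qed.

Lemma bounded_borel_integrable f : bounded_borel f ->
  mu.-integrable (A : set (borel X)) (EFin \o f).
Proof.
move=> [mf [M fM]]; apply: measurable_bounded_integrable => //.
- by case/andP: A0.
- exact: measurable_funTS mf.
- exists M; split; first exact: num_real.
  by move=> N MN x _; exact: le_trans (fM x) (ltW MN).
Qed.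

Lemma average_EFin f : bounded_borel f ->
  average mu A (EFin \o f) = (mean A f)%:E.
Proof.
move=> bf; rewrite /average /mean EFinM; congr (_ * _)%E.
by rewrite fineK//; exact/integrable_fin_num/bounded_borel_integrable.
Qed.

Lemma mean_cst (k : R) : mean A (fun=> k) = k.
Proof. by rewrite /mean Rintegral_cst//= mulrCA mulVf ?mulr1 ?gt_eqF. Qed.

Lemma le_mean f g : bounded_borel f -> bounded_borel g ->
  (forall x, A x -> f x <= g x) -> mean A f <= mean A g.
Proof.
move=> bf bg fg; rewrite /mean ler_wpM2l// ?invr_ge0 ?fine_ge0//.
by apply: le_Rintegral => //; exact: bounded_borel_integrable.
Qed.

Lemma mean_subr f (k : R) : bounded_borel f ->
  `|mean A f - k| <= mean A (fun x => `|f x - k|).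
Proof.
move=> bf; have ifA := bounded_borel_integrable bf.
have ik : mu.-integrable (A : set (borel X)) (EFin \o (fun=> k)).
  apply: bounded_borel_integrable; split; first exact: measurable_cst.
  by exists `|k|.
have -> : mean A f - k = mean A (fun x => f x - k).
  by rewrite -[X in _ - X](mean_cst k) /mean RintegralB// mulrBr.
rewrite /mean normrM ger0_norm ?invr_ge0 ?fine_ge0// ler_wpM2l// ?invr_ge0 ?fine_ge0//.
apply: le_normr_Rintegral => //.
by have := integrableB mA ifA ik; congr (integrable _ _ _).
Qed.

Lemma mean_subset B f (M : R) : measurable (B : set (borel X)) ->
  (0 < mu B < +oo)%E -> B `<=` A -> (mu A <= M%:E * mu B)%E ->
  bounded_borel f -> (forall x, 0 <= f x) -> mean B f <= M * mean A f.
Proof.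
move=> mB B0 BA muAB bf f0.
have finB : 0 < fine (mu B) by exact: fine_gt0.
have muM : fine (mu A) <= M * fine (mu B).
  rewrite -lee_fin EFinM !fineK// ge0_fin_numE//.
    by case/andP: B0.
  by case/andP: A0.
have I0 : 0 <= Rintegral mu (A : set (borel X)) f by exact: Rintegral_ge0.
apply: (@le_trans _ _ ((fine (mu B))^-1 * Rintegral mu (A : set (borel X)) f)).
  rewrite /mean ler_wpM2l// ?invr_ge0 ?(ltW finB)//.
  rewrite /Rintegral fine_le//.
  - apply: integrable_fin_num => //.
    exact: integrableS mA mB BA (bounded_borel_integrable bf).
  - exact/integrable_fin_num/bounded_borel_integrable.
  - apply: ge0_subset_integral => //.
    + by apply/measurable_EFinP; case: bf => mf _; exact: measurable_funTS mf.
    + by move=> x _; rewrite lee_fin.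
rewrite /mean mulrA ler_wpM2r//.
by rewrite ler_pdivlMr// mulrC ler_pdivrMr.
Qed.

End mean.
End averages.

(** * Crossings of Lipschitz functions on the line *)

Section crossing.
Context {R : realType}.
Implicit Types (f : R -> R).

(** A segment of the line is cut into steps of length [e / 2], whose lengths add up exactly to the
    total. *)
Lemma lipschitz_of_local f (e : R) : 0 < e ->
  (forall s t, `|s - t| < e -> `|f s - f t| <= `|s - t|) ->
  forall s t, `|f s - f t| <= `|s - t|.
Proof.
move=> e0 lf s t; wlog st : s t / s <= t.
  move=> H; have [/H//|/ltW/H] := leP s t.
  by rewrite distrC (distrC t).
have [n] : exists n : nat, t - s < n%:R * (e / 2).
  exists (Num.bound ((t - s) / (e / 2))); rewrite -ltr_pdivrMr ?divr_gt0//.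
  by apply: archi_boundP; rewrite divr_ge0 ?subr_ge0 ?divr_ge0// ltW.
elim: n s t st => [|n IHn] s t st; first by rewrite mul0r; lra.
rewrite -addn1 natrD mulrDl mul1r => stn.
have [tse|tse] := ltP (t - s) e.
  by apply: lf; rewrite distrC ger0_norm ?subr_ge0.
pose u := s + e / 2.
have us : `|s - u| = u - s by rewrite distrC gtr0_norm /u; lra.
have su : `|f s - f u| <= u - s by rewrite -us; apply: lf; rewrite us /u; lra.
have ut : u <= t by rewrite /u; lra.
have {}IHn : `|f u - f t| <= t - u.
  rewrite -[t - u]ger0_norm ?subr_ge0// [leRHS]distrC.
  by apply: IHn; rewrite /u; lra.
rewrite [leRHS]distrC [leRHS]ger0_norm ?subr_ge0//.
apply: le_trans (ler_distD (f u) _ _) _; lra.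
Qed.

(** [s] is the last time with value at most [alpha], and [t] the first time after [s] with value at
    least [beta]; the Lipschitz bound then keeps them [beta - alpha] apart. *)
Lemma crossing f (l alpha beta : R) :
  (forall s t, `|f s - f t| <= `|s - t|) -> 0 <= l ->
  f 0 <= alpha -> alpha < beta -> beta <= f l ->
  exists s t, [/\ 0 <= s, t <= l, beta - alpha <= t - s &
    forall x, s < x < t -> alpha < f x < beta].
Proof.
move=> lf l0 f0 ab fl.
pose S := [set x | 0 <= x <= l /\ f x <= alpha].
have supS : has_sup S.
  by split; [exists 0; split; rewrite ?lexx ?l0|exists l => x [/andP[]]].
pose s := sup S.
have s0 : 0 <= s by apply: (ub_le_sup supS.2); split; rewrite ?lexx ?l0.
have sl : s <= l by apply: (ge_sup supS.1) => x [/andP[]].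
have fs : f s <= alpha.
  apply/ler_addgt0Pr => e e0; have [x Sx sx] := sup_adherent e0 supS.
  have xs : x <= s := ub_le_sup supS.2 Sx.
  case: Sx => _ fx; have := le_trans (ler_norm _) (lf s x).
  by rewrite ger0_norm ?subr_ge0// -/s in sx *; lra.
have afs x : s < x -> x <= l -> alpha < f x.
  move=> sx xl; rewrite ltNge; apply/negP => fx.
  have : x <= s by apply: (ub_le_sup supS.2); split => //; rewrite xl (le_trans s0 (ltW sx)).
  by rewrite leNgt sx.
pose T := [set x | s <= x <= l /\ beta <= f x].
have infT : has_inf T.
  by split; [exists l; split; rewrite ?lexx ?sl|exists s => x [/andP[]]].
pose t := inf T.
have st : s <= t by apply: (lb_le_inf infT.1) => x [/andP[]].
have tl : t <= l by apply: (ge_inf infT.2); split; rewrite ?lexx ?sl.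
have ft : beta <= f t.
  apply/ler_addgt0Pr => e e0.
  have [x Tx tx] := inf_adherent e0 infT.
  have xs : t <= x := ge_inf infT.2 Tx.
  case: Tx => _ fx; have := le_trans (ler_norm _) (lf x t).
  by rewrite ger0_norm ?subr_ge0// -/t in tx *; lra.
have ftb x : s <= x -> x < t -> f x < beta.
  move=> sx xt; rewrite ltNge; apply/negP => fx.
  have : t <= x by apply: (ge_inf infT.2); split => //; rewrite sx (le_trans (ltW xt) tl).
  by rewrite leNgt xt.
exists s, t; split => //.
  have := le_trans (ler_norm _) (lf t s).
  by rewrite ger0_norm ?subr_ge0//; lra.
move=> x /andP[sx xt]; rewrite ftb ?(ltW sx)// andbT afs//.
exact: le_trans (ltW xt) tl.
Qed.
End crossing.

(** * The Poincare inequality for locally 1-Lipschitz test functions *)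

Section poincare_estimate.
Context {R : realType} {X : completeMetricType R}.
Variables (mu : {measure set (borel X) -> \bar R}) (p : R).
Local Notation lebesgue := (@lebesgue_measure R).

(** Passing from the value [alpha] to [beta] takes time at least [beta - alpha], during which [rho]
    is at least 1. *)
Lemma line_integral_crossing (c : R * (R -> X)) (f : X -> R) (rho : X -> \bar R)
    (alpha beta : R) :
  arclength_curve c -> nonneg_borel rho ->
  (forall s t, `|f (clamped c s) - f (clamped c t)| <= `|s - t|) ->
  f (c.2 0) <= alpha -> alpha <= beta -> beta <= f (c.2 c.1) ->
  (forall x, alpha < f x < beta -> (1 <= rho x)%E) ->
  ((beta - alpha)%:E <= line_integral c rho)%E.
Proof.
move=> arc brho lf f0 + fl hrho.
have rho0 x : (0 <= rho x)%E by case: brho.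
rewrite le_eqVlt => /predU1P[->|ab]; first by rewrite subrr; exact: integral_ge0.
have c0 : 0 <= c.1 by case: arc => /ltW.
rewrite -(@clamped_id _ _ c 0) ?lexx ?c0// in f0.
rewrite -(@clamped_id _ _ c c.1) ?lexx ?c0// in fl.
have [s [t [s0 tl bt hst]]] := @crossing R (fun t => f (clamped c t)) _ _ _ lf c0 f0 ab fl.
have mrho := measurable_comp_clamped arc brho.
rewrite line_integral_clamped.
apply: (@le_trans _ _ (\int[lebesgue]_(x in `]s, t[) rho (clamped c x))%E).
  apply: (@le_trans _ _ (\int[lebesgue]_(x in `]s, t[) (cst 1%E x))%E).
    rewrite integral_cst//= mul1e lebesgue_measure_itv/= lte_fin ifT; last by lra.
    by rewrite -EFinB lee_fin.
  apply: ge0_le_integral => //; first exact: measurable_funTS mrho.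
  by move=> x /=; rewrite in_itv/= => /hst; exact: hrho.
apply: ge0_subset_integral => //; first exact: measurable_funTS mrho.
by move=> x /=; rewrite !in_itv/= => /andP[? ?]; apply/andP; split; lra.
Qed.

Lemma indic_nonneg_borel (A : set X) : measurable (A : set (borel X)) ->
  nonneg_borel (fun x => (\1_A x)%:E : \bar R).
Proof.
move=> mA; split; last by move=> x; rewrite lee_fin.
by apply/measurable_EFinP; exact: measurable_indic.
Qed.

Lemma continuous_borel_fun (f : X -> R) : continuous f ->
  measurable_fun setT (f : borel X -> R).
Proof.
move=> /continuousP cf; apply: (measurability _ (RGenOpens.measurableE R)).
move=> _ [_ [a [b ->]] <-]; rewrite setTI; apply: sub_sigma_algebra.
by apply: cf; exact: interval_open.
Qed.

Section test_function.
Variables (f : X -> R) (e : R).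
Hypotheses (e0 : 0 < e)
  (lip_f : forall z w, mdist z w < e -> `|f z - f w| <= mdist z w)
  (f_ge0 : forall x, 0 <= f x).

(** On [X] the bound is known only at scale [e]; along a curve it holds at every scale by
    [lipschitz_of_local]. *)
Lemma locally_lipschitz_along c : arclength_curve c ->
  forall s t, `|f (clamped c s) - f (clamped c t)| <= `|s - t|.
Proof.
move=> arc; apply: (lipschitz_of_local e0) => s t ste.
have cl := clamped_lipschitz arc s t.
by apply: (le_trans _ cl); apply: lip_f; exact: le_lt_trans cl ste.
Qed.

Lemma locally_lipschitz_continuous : continuous f.
Proof.
move=> x; apply/cvgrPdist_lt => r r0; apply/nbhs_ballP.
exists (Num.min r e); first by rewrite /= lt_min r0.
move=> y; rewrite ballEmdist /= lt_min => /andP[xr xe].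
exact: le_lt_trans (lip_f xe) xr.
Qed.

(** Only the part of the curve on which [f] lies strictly between its two end values is used. There
    [f > 0], so the constant 1 may be cut off outside a ball that contains the set [f > 0]. *)
Lemma upper_gradient_ball (a : X) (r : R) :
  (forall x, 0 < f x -> ball a r x) ->
  upper_gradient (EFin \o f) (fun x => (\1_(ball a r) x)%:E).
Proof.
move=> fr; have b1 := indic_nonneg_borel (measurable_ball a r).
split=> // c arc; split=> [_|[]//] /=.
have lf := locally_lipschitz_along arc.
have [le0|gt0] := lerP (f (c.2 0) - f (c.2 c.1)) 0.
  rewrite ler0_norm// opprB.
  apply: (line_integral_crossing arc b1 lf) => //; first by rewrite -subr_le0.
  move=> x /andP[fx _]; rewrite indicE mem_set//; apply: fr.
  exact: le_lt_trans (f_ge0 _) fx.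
rewrite gtr0_norm// (_ : _ - _ = - f (c.2 c.1) - - f (c.2 0)); last by lra.
apply: (@line_integral_crossing c (fun x => - f x) _ _ _ arc b1) => //.
- by move=> s t; rewrite opprK addrC distrC; exact: lf.
- by rewrite lerN2 -subr_ge0 ltW.
- move=> x /andP[_]; rewrite ltrN2 => fx; rewrite indicE mem_set//; apply: fr.
  exact: le_lt_trans (f_ge0 _) fx.
Qed.

(** The indicator of a ball is an upper gradient of [f], so the minimal one is at most 1 almost
    everywhere and the Poincare bound reduces to [C] times the diameter. Boundedness of [f] and of
    the set [f > 0] makes [f] Newtonian. *)
Lemma test_function_estimate (C lambda M : R) (a : X) (r : R) :
  (forall (a : X) (r : R), 0 < r -> (0 < mu (ball a r) < +oo)%E) ->
  1 <= p -> 0 < C -> 1 <= lambda ->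
  (forall (x : X) (r : R) u g, 0 < r ->
    newtonian mu p u -> minimal_weak_upper_gradient mu p u g ->
    (average mu (ball x r) (fun y => `|u y - average mu (ball x r) u|) <=
     C%:E * diam (ball x r) *
       (average mu (ball x (lambda * r)) (fun y => g y `^ p)) `^ p^-1)%E) ->
  (forall x, f x <= M) -> (forall x, 0 < f x -> ball a r x) ->
  forall x s, 0 < s ->
    mean mu (ball x s) (fun y => `|f y - mean mu (ball x s) f|) <= C * (2 * s).
Proof.
move=> mu_ball p1 C0 lam1 PI fM fr x s s0.
have p0 : 0 < p by lra.
have mf : measurable_fun setT (f : borel X -> R).
  exact: (continuous_borel_fun locally_lipschitz_continuous).
have bf : bounded_borel f.
  by split => //; exists M => y; rewrite ger0_norm.
have muB y t : 0 < t -> (0 < mu (ball y t) < +oo)%E by exact: mu_ball.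
have mB y t : measurable (ball y t : set (borel X)) by exact: measurable_ball.
(* [r] need not be positive, while [mu_ball] concerns positive radii. *)
pose r' := Num.max r 1.
have r'0 : 0 < r' by rewrite lt_max ltr01 orbT.
have fr' y : 0 < f y -> ball a r' y.
  by move=> /fr; apply: le_ball; rewrite /r' le_max lexx.
have ug := upper_gradient_ball fr'.
pose h : X -> \bar R := fun y => (\1_(ball a r') y)%:E.
have hfin : (ppower_integral mu p h < +oo)%E.
  rewrite ppower_integralE; last by move=> y; rewrite lee_fin.
  have -> : (\int[mu]_y (h y `^ p) = \int[mu]_y h y)%E.
    apply: eq_integral => y _; rewrite /h indicE.
    by case: (_ \in _); rewrite ?poweR1r// poweR0r// gt_eqF.
  by rewrite integral_indic// setIT; case/andP: (muB a r' r'0).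
have wug : weak_upper_gradient mu p (EFin \o f) h.
  case: ug => bh ug; split => //; exists set0 => [|c arc _]; last exact: ug.
  exists (cst 0%E); split => //.
  - rewrite /ppower_integral integral0_eq ?ltry// => y _.
    by rewrite abse0 poweR0r// gt_eqF.
have [g gmin] := minimal_weak_upper_gradient_exists p0
  (fun c arc => locally_lipschitz_along arc) wug hfin.
have newt : newtonian mu p (EFin \o f).
  split; first exact/measurable_EFinP.
  rewrite lte_add_pinfty//.
    have M0 : 0 <= M by exact: le_trans (f_ge0 x) (fM x).
    apply: (@le_lt_trans _ _ (\int[mu]_y ((M `^ p)%:E * h y))%E).
      rewrite ppower_integralE//; apply: ge0_le_integral => //.
      - by move=> y _; exact: poweR_ge0.
      - apply: (@measurable_ppower _ _ p (EFin \o f)).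
        by split => //; exact/measurable_EFinP.
      - by apply: measurable_funeM; case: ug => -[].
      move=> y _; have [fy|fy] := ltP 0 (f y).
        rewrite /h indicE mem_set ?mule1; last exact: fr'.
        by rewrite -poweR_EFin; apply: le_poweR; rewrite ?lee_fin// ltW.
      have -> : (EFin \o f) y = 0%E by congr EFin; apply/eqP; rewrite eq_le fy f_ge0.
      by rewrite poweR0r ?gt_eqF// mule_ge0// lee_fin ?powR_ge0//; exact: indic_ge0.
    rewrite ge0_integralZl//; last 3 first.
    - by case: ug => -[].
    - by move=> y _; rewrite lee_fin.
    - by rewrite lee_fin powR_ge0.
    rewrite integral_indic// setIT.
    have /andP[B0 Boo] := muB a r' r'0.
    by rewrite lte_mul_pinfty// ?lee_fin ?powR_ge0.
  apply: le_lt_trans hfin; apply: ge_ereal_inf.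
  by exists (ppower_integral mu p h) => //; exists h.
have := PI x s _ _ s0 newt gmin.
rewrite (average_EFin (mB x s) (muB x s s0) bf).
have -> : (fun y => `|(EFin \o f) y - (mean mu (ball x s) f)%:E|%E) =
    EFin \o (fun y => `|f y - mean mu (ball x s) f|) by apply/funext.
have bfm : bounded_borel (fun y => `|f y - mean mu (ball x s) f|).
  split; first by apply: measurableT_comp => //; exact: measurable_funB.
  exists (M + `|mean mu (ball x s) f|) => y; rewrite normr_id.
  by apply: le_trans (ler_normB _ _) _; rewrite lerD2r ger0_norm.
rewrite (average_EFin (mB x s) (muB x s s0) bfm) -lee_fin => /le_trans; apply.
have ls0 : 0 < lambda * s by rewrite mulr_gt0//; lra.
have bg : nonneg_borel g by case: gmin => -[].
have avg0 : (0 <= average mu (ball x (lambda * s)) (fun y => g y `^ p))%E.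
  rewrite /average mule_ge0 ?lee_fin ?invr_ge0 ?fine_ge0//.
  by apply: integral_ge0 => y _; exact: poweR_ge0.
rewrite EFinM; apply: (@le_trans _ _ (C%:E * (2 * s)%:E * 1)%E); last by rewrite mule1.
apply: lee_pmul => //.
- rewrite mule_ge0 ?lee_fin ?(ltW C0)// /diam.
  apply: le_ereal_sup_tmp; exists 0%E => //; exists x; first exact: ballxx.
  by exists x; [exact: ballxx|rewrite mdistxx].
- exact: poweR_ge0.
- rewrite lee_pmul2l//; apply: ge_ereal_sup => _ [y + [z + <-]].
  rewrite !ballEmdist/= => xy xz; rewrite lee_fin.
  by apply: le_trans (metric_triangle y x z) _; rewrite (metric_sym y); lra.
(* It remains to bound the average of [g ^ p] by 1, which follows from [g <= h <= 1] almost
   everywhere, by minimality. *)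
rewrite -[leRHS](poweR1r p^-1); apply: le_poweR => //; first by rewrite invr_ge0 ltW.
case/andP: (muB x _ ls0) => B0 Boo.
have Bfin : mu (ball x (lambda * s)) \is a fin_num by rewrite ge0_fin_numE.
apply: (@le_trans _ _ ((fine (mu (ball x (lambda * s))))^-1%:E * mu (ball x (lambda * s)))%E).
  rewrite /average; apply: lee_wpmul2l.
    by rewrite lee_fin invr_ge0 fine_ge0.
  rewrite -[leRHS]mul1e -integral_cst; last exact: mB.
  apply: ae_ge0_le_integral => //.
  - by move=> y _; exact: poweR_ge0.
  - exact: measurable_funTS (measurable_ppower p bg).
  case: gmin => _ _ /(_ h wug hfin) [N [mN N0 hN]].
  exists N; split => // y /= ngh; apply: hN => /= gh; apply: ngh => _.
  rewrite -[leRHS](poweR1r p); apply: le_poweR; [exact: ltW|by case: bg|].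
  by apply: le_trans gh _; rewrite /h lee_fin indicE; case: (_ \in _); rewrite ?lexx ?ler01.
by rewrite -[X in (_ * X)%E](fineK Bfin) -EFinM mulVf// gt_eqF// fine_gt0// B0.
Qed.
End test_function.
End poincare_estimate.

Lemma exists_div_exp2_lt (R : realType) (s d : R) : 0 <= s -> 0 < d ->
  exists n, s / 2 ^+ n < d.
Proof.
move=> s0 d0; exists (Num.bound (s / d)).
rewrite ltr_pdivrMr ?exprn_gt0// mulrC -ltr_pdivrMr//.
apply: lt_trans (archi_boundP _) _; first by rewrite divr_ge0// ltW.
by rewrite -natrX ltr_nat ltn_expl.
Qed.

(** * A Lipschitz constant independent of the scale *)

Section poincare_consequences.
Context {R : realType} {X : completeMetricType R}.
Variables (mu : {measure set (borel X) -> \bar R}) (p : R).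
Hypotheses (mu_ball : forall (a : X) (r : R), 0 < r -> (0 < mu (ball a r) < +oo)%E)
  (p_ge1 : 1 <= p) (mu_doubling : doubling mu) (X_poincare : poincare mu p).

(* Telescoping over the balls [ball x (r / 2 ^ n)]. *)
Lemma poincare_lipschitz : exists2 K : R, 0 < K & forall (f : X -> R) (e M r : R) (a : X),
  0 < e -> (forall z w, mdist z w < e -> `|f z - f w| <= mdist z w) ->
  (forall x, 0 <= f x) -> (forall x, f x <= M) -> (forall x, 0 < f x -> ball a r x) ->
  forall x y, `|f x - f y| <= K * mdist x y.
Proof.
have [D D0 hD] := mu_doubling.
have [C [lambda [C0 lam1 PI]]] := X_poincare.
(* Halving the radius [s] changes the mean by at most [k s], so the geometric series bounds the
   distance from [f x] to the mean over [ball x s] by [2 k s]. *)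
pose k : R := D * (C * 2).
have k0 : 0 < k by rewrite /k !mulr_gt0.
(* With [s] the distance from [x] to [y], the series cost [4 k s] on [ball x (2 s)] and [2 k s] on
   [ball y s]; the last summand is the cost of comparing these two balls. *)
pose K : R := 6 * k + D * D * (C * 4).
have K0 : 0 < K by rewrite /K addr_gt0// !mulr_gt0.
exists K => // f e M r a e0 lf f0 fM fr.
have mB y t : measurable (ball y t : set (borel X)) by exact: measurable_ball.
have bf : bounded_borel f.
  split; last by exists M => y; rewrite ger0_norm.
  exact: (continuous_borel_fun (locally_lipschitz_continuous e0 lf)).
have bfm m : bounded_borel (fun y => `|f y - m|).
  split; first by apply: measurableT_comp => //; apply: measurable_funB => //; case: bf.
  exists (M + `|m|) => y; rewrite normr_id.
  by apply: le_trans (ler_normB _ _) _; rewrite lerD2r ger0_norm.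
pose m x s := mean mu (ball x s) f.
have est x s : 0 < s -> mean mu (ball x s) (fun y => `|f y - m x s|) <= C * (2 * s).
  move=> s0.
  exact: (test_function_estimate e0 lf f0 mu_ball p_ge1 C0 lam1 PI fM fr x s0).
have step x y s t (N : R) : 0 < s -> 0 < t -> 0 <= N -> ball x s `<=` ball y t ->
    (mu (ball y t) <= N%:E * mu (ball x s))%E ->
    `|m x s - m y t| <= N * (C * (2 * t)).
  move=> s0 t0 N0 sub muN.
  apply: le_trans (mean_subr (mB x s) (mu_ball x s0) (m y t) bf) _.
  apply: le_trans (mean_subset (mB y t) (mu_ball y t0) (mB x s) (mu_ball x s0)
    sub muN (bfm _) _) _ => //.
  by rewrite ler_wpM2l// est.
have half x s : 0 < s -> `|m x (s / 2) - m x s| <= k * s.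
  move=> s0; have s20 : 0 < s / 2 by rewrite divr_gt0.
  rewrite /k -mulrA -(mulrA C); apply: step => //; first exact: ltW.
    by apply: le_ball; lra.
  by have := hD x (s / 2) s20; rewrite mulrC divfK.
have tele x s n : 0 < s -> `|m x (s / 2 ^+ n) - m x s| <= 2 * k * s * (1 - 2^-1 ^+ n).
  move=> s0; elim: n => [|n IHn].
    by rewrite !expr0 divr1 !subrr normr0 mulr0.
  have sn0 : 0 < s / 2 ^+ n by rewrite divr_gt0// exprn_gt0.
  have := half x _ sn0; rewrite -mulrA -invfM -exprSr => hn.
  apply: le_trans (ler_distD (m x (s / 2 ^+ n)) _ _) _.
  apply: le_trans (lerD hn IHn) _.
  rewrite exprS -exprVn.
  move: (2^-1 ^+ n) => q; lra.
have mlim x s : 0 < s -> `|f x - m x s| <= 2 * k * s.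
  move=> s0; apply/ler_addgt0Pr => d d0.
  (* Below radius [e] the local Lipschitz bound applies, and below [d] it keeps the mean within [d]
     of [f x]. *)
  pose d' := Num.min d e.
  have d'0 : 0 < d' by rewrite lt_min d0.
  have [n hn] := exists_div_exp2_lt (ltW s0) d'0.
  have sn0 : 0 < s / 2 ^+ n by rewrite divr_gt0// exprn_gt0.
  have hm : `|f x - m x (s / 2 ^+ n)| <= d.
    rewrite distrC; apply: le_trans (mean_subr (mB _ _) (mu_ball x sn0) (f x) bf) _.
    rewrite -[leRHS](mean_cst (mB x (s / 2 ^+ n)) (mu_ball x sn0)).
    apply: (le_mean (mB x _) (mu_ball x sn0)) => //.
      by split; [exact: measurable_cst|exists `|d|].
    move=> z; rewrite ballEmdist /= => xz; rewrite distrC.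
    move: hn; rewrite lt_min => /andP[nd ne].
    apply: le_trans (lf _ _ (lt_trans xz ne)) _.
    by rewrite ltW// (lt_trans xz).
  apply: le_trans (ler_distD (m x (s / 2 ^+ n)) _ _) _.
  rewrite addrC lerD//; apply: le_trans (tele x s n s0) _.
  have q0 : 0 <= 2^-1 ^+ n :> R by rewrite exprn_ge0// invr_ge0.
  apply: ler_piMr; last by lra.
  by rewrite !mulr_ge0// ltW.
move=> x y; have [->|xy] := eqVneq x y; first by rewrite subrr normr0 mdistxx mulr0.
set s := mdist x y.
have s0 : 0 < s by rewrite mdist_gt0.
have s20 : 0 < 2 * s by rewrite mulr_gt0.
have hstep : `|m y s - m x (2 * s)| <= D * D * (C * (2 * (2 * s))).
  apply: step => //; first by rewrite mulr_ge0 ?ltW.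
    move=> z; rewrite !ballEmdist /= => yz.
    by apply: le_lt_trans (metric_triangle x y z) _; rewrite -/s; lra.
  (* [ball x (2 s)] lies in [ball y (4 s)], which is two doublings away from [ball y s]. *)
  apply: (@le_trans _ _ (mu (ball y (2 * (2 * s))))).
    apply: le_measure; rewrite ?inE//.
    move=> z; rewrite !ballEmdist /= => xz.
    apply: le_lt_trans (metric_triangle y x z) _; rewrite metric_sym -/s; lra.
  apply: le_trans (hD _ _ s20) _; rewrite EFinM -muleA lee_pmul2l//.
  exact: hD.
have h1 := mlim x _ s20; have h2 := mlim y _ s0.
rewrite /K; move: (k) h1 h2 hstep => k' /ler_normlP[? ?] /ler_normlP[? ?] /ler_normlP[? ?].
by apply/ler_normlP; split; lra.
Qed.

End poincare_consequences.

(** * Chains and paths *)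

Section chains.
Context {R : realType} {X : metricType R}.

Inductive echain (e : R) (a : X) : X -> R -> Prop :=
| echain_nil : echain e a a 0
| echain_rcons z w s : echain e a z s -> mdist z w < e ->
    echain e a w (s + mdist z w).

Lemma echain_length e a z s : echain e a z s -> mdist a z <= s.
Proof.
elim=> [|z' w s' _ IH _]; first by rewrite mdistxx.
by apply: le_trans (metric_triangle a z' w) _; rewrite lerD2r.
Qed.

(** This is max(0, L - rho_e(a, z)), where rho_e is the infimum of the lengths of [e]-chains. As a
    supremum of a set containing 0 it needs no convention for points that no [e]-chain reaches. *)
Definition chain_height (e L : R) (a z : X) : R :=
  sup [set r | r = 0 \/ exists2 s, echain e a z s & r = L - s].

Section chain_height.
Variables (e L : R) (a : X).
Hypothesis L0 : 0 <= L.
Local Notation u := (chain_height e L a).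

Let height_sup z : has_sup [set r | r = 0 \/ exists2 s, echain e a z s & r = L - s].
Proof.
split; first by exists 0; left.
exists L => _ [->//|[s /echain_length zs ->]].
by rewrite lerBlDr lerDl (le_trans (mdist_ge0 _ _) zs).
Qed.

Lemma chain_height_ge0 z : 0 <= u z.
Proof. by apply: (ub_le_sup (height_sup z).2); left. Qed.

Lemma chain_height_ge z s : echain e a z s -> L - s <= u z.
Proof. by move=> azs; apply: (ub_le_sup (height_sup z).2); right; exists s. Qed.

Lemma chain_height_le z : u z <= L.
Proof.
apply: (ge_sup (height_sup z).1) => _ [->//|[s /echain_length zs ->]].
by rewrite lerBlDr lerDl (le_trans (mdist_ge0 _ _) zs).
Qed.

Lemma chain_height_gt0 z : 0 < u z -> exists2 s, echain e a z s & s < L.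
Proof.
move=> uz; have [_ [->|[s azs ->]]] := sup_adherent uz (height_sup z).
  by rewrite subrr ltxx.
by rewrite subrr subr_gt0 => sL; exists s.
Qed.

(** A step shorter than [e] can be appended to any [e]-chain, so the height drops by at most the
    length of that step. *)
Lemma chain_height_lipschitz z w : mdist z w < e -> `|u z - u w| <= mdist z w.
Proof.
have le z' w' : mdist z' w' < e -> u z' - u w' <= mdist z' w'.
  move=> zwe; rewrite lerBlDr; apply: (ge_sup (height_sup z').1).
  move=> _ [->|[s azs ->]]; first by rewrite addr_ge0 ?mdist_ge0 ?chain_height_ge0.
  have := chain_height_ge (echain_rcons azs zwe); lra.
move=> zwe; have := le _ _ zwe; have := le w z; rewrite metric_sym => /(_ zwe).
by move=> ? ?; apply/ler_normlP; split; lra.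
Qed.

End chain_height.

(* Greedily, the next point is kept as soon as the length accumulated since the
   last kept point exceeds [e]; [t] is the part not yet accounted for. *)
Lemma echain_regroup e a z s : 0 < e -> echain e a z s ->
  exists (n : nat) (v : nat -> X) (t : R),
    [/\ v 0%N = a, forall i, (i < n)%N -> mdist (v i) (v i.+1) <= 2 * e,
        mdist (v n) z <= t, 0 <= t <= e & n%:R * e + t <= s].
Proof.
move=> e0; elim=> [|z' w s' _ [n [v [t [v0 vs vz /andP[t0 te] le]]]] zw].
  exists 0%N, (fun=> a), 0; rewrite mdistxx mul0r addr0 lexx.
  by split => //; rewrite ltW.
have d0 := mdist_ge0 z' w.
have vw : mdist (v n) w <= t + mdist z' w.
  by apply: le_trans (metric_triangle _ z' _) _; rewrite lerD2r.
have [tw|tw] := ltP (t + mdist z' w) e.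
  exists n, v, (t + mdist z' w); split => //.
  + by rewrite (ltW tw) andbT addr_ge0.
  + by lra.
exists n.+1, (fun i => if (i <= n)%N then v i else w), 0; split => //.
- move=> i; rewrite ltnS /=; case: (ltngtP i n) => [in_ _|//|-> _].
    exact: vs.
  by lra.
- by rewrite /= ltnn mdistxx.
- by rewrite lexx ltW.
- by rewrite -addn1 natrD mulrDl mul1r; lra.
Qed.

End chains.

(** * Short chains between any two points *)

Section quasiconvexity.
Context {R : realType} {X : completeMetricType R}.
Variables (mu : {measure set (borel X) -> \bar R}) (p : R).
Hypotheses (mu_ball : forall (a : X) (r : R), 0 < r -> (0 < mu (ball a r) < +oo)%E)
  (p_ge1 : 1 <= p) (mu_doubling : doubling mu) (X_poincare : poincare mu p).

(** With [L = (K + 1) d(a, b)] the height is at least [L] at [a] and [K]-Lipschitz, so it is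
    positive at [b]: an [e]-chain shorter than [L] reaches [b]. Here [K] does not depend on [e]. *)
Lemma echain_exists : exists2 K : R, 0 < K & forall (e : R) (a b : X), 0 < e ->
  a != b -> exists2 s, echain e a b s & s < K * mdist a b.
Proof.
have [K K0 hK] := poincare_lipschitz mu_ball p_ge1 mu_doubling X_poincare.
exists (K + 1) => [|e a b e0 ab]; first by rewrite addr_gt0.
have d0 : 0 < mdist a b by rewrite mdist_gt0.
set L := _ * _; have L0 : 0 <= L by rewrite mulr_ge0 ?ltW// addr_gt0.
apply: (@chain_height_gt0 _ _ e L a L0 b).
have := hK (chain_height e L a) e L L a e0
  (@chain_height_lipschitz _ _ e L a L0) (@chain_height_ge0 _ _ e L a L0)
  (@chain_height_le _ _ e L a L0).
have supp x : 0 < chain_height e L a x -> ball a L x.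
  move=> /(chain_height_gt0 L0)[s /echain_length axs sL].
  by rewrite ballEmdist /=; exact: le_lt_trans axs sL.
move=> /(_ supp a b) /ler_normlP[_].
have := chain_height_ge L0 (echain_nil e a).
by rewrite /L; lra.
Qed.

(** For [e = d(a, b) / 4], an [e]-chain of length below [K d(a, b)] regroups into fewer than [4 K]
    steps of length at most [2 e], plus a remainder of length at most [e]. *)
Lemma halving_chain : exists2 N : nat, (0 < N)%N & forall a b : X,
  exists z : nat -> X, [/\ z 0%N = a, z N = b &
    forall i, (i < N)%N -> mdist (z i) (z i.+1) <= mdist a b / 2].
Proof.
have [K K0 hK] := echain_exists.
exists (Num.bound (4 * K)).+1 => // a b.
have [->|ab] := eqVneq a b.
  by exists (fun=> b); split => // i _; rewrite mdistxx mul0r.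
have d0 : 0 < mdist a b by rewrite mdist_gt0.
have e0 : 0 < mdist a b / 4 by rewrite divr_gt0.
have [s abs sK] := hK _ _ _ e0 ab.
have [n [v [t [v0 vs vb /andP[t0 te] le]]]] := echain_regroup e0 abs.
have nN : (n <= Num.bound (4 * K))%N.
  rewrite -(ler_nat R); apply: ltW.
  apply: lt_trans (archi_boundP _); last by rewrite mulr_ge0// ltW.
  rewrite -(ltr_pM2r e0); lra.
(* Repeating [b] brings the number of steps to [N], the same for all pairs of points. *)
exists (fun i => if (i <= n)%N then v i else b); split => //.
  by rewrite ifF//; apply/negbTE; rewrite -ltnNge ltnS.
move=> i _; case: (ltngtP i n) => [in_|ni|->].
- by apply: le_trans (vs _ in_) _; lra.
- by rewrite mdistxx divr_ge0// mdist_ge0.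
- by apply: le_trans vb _; lra.
Qed.

End quasiconvexity.

(** * Paths as limits of refined chains *)

Section refinement.
Context {R : realType} {X : completeMetricType R}.

Lemma geometric_cauchy_limit (x : nat -> X) (c : R) : 0 <= c ->
  (forall k, mdist (x k) (x k.+1) <= c / 2 ^+ k.+1) ->
  exists l, forall k, mdist (x k) l <= c / 2 ^+ k.
Proof.
move=> c0 xc.
have cE k : c / 2 ^+ k = c / 2 ^+ k.+1 + c / 2 ^+ k.+1.
  by rewrite exprS invfM; lra.
have dist k n : mdist (x k) (x (k + n)%N) <= c / 2 ^+ k - c / 2 ^+ (k + n).
  elim: n => [|n IHn]; first by rewrite addn0 mdistxx subrr.
  rewrite addnS; apply: le_trans (metric_triangle _ (x (k + n)%N) _) _.
  by have := xc (k + n)%N; have := cE (k + n)%N; lra.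
have dist' k m : (k <= m)%N -> mdist (x k) (x m) <= c / 2 ^+ k.
  move=> km; have := dist k (m - k)%N; rewrite subnKC// => H.
  by apply: le_trans H _; rewrite gerBl divr_ge0// exprn_ge0.
have cx : cvg (x @ \oo).
  apply/cauchy_cvgP/cauchyP => e e0.
  have [k ke] := exists_div_exp2_lt c0 e0.
  exists (x k); exists k => // m /= km; rewrite ballEmdist /=.
  exact: le_lt_trans (dist' _ _ km) ke.
exists (lim (x @ \oo)) => k; apply/ler_addgt0Pr => e e0.
have /metricType_numDomainType.cvgrPdist_lt/(_ _ e0)[m _ hm] := cx.
have := hm (k + m)%N (leq_addl _ _); rewrite metric_sym => hkm.
apply: le_trans (metric_triangle _ (x (k + m)%N) _) _.
by apply: lerD; [exact/dist'/leq_addr|exact: ltW].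
Qed.

Section refine.
Variables (N : nat) (Z : X -> X -> nat -> X) (a b : X).
Hypotheses (N0 : (0 < N)%N)
  (Z0 : forall x y, Z x y 0%N = x) (ZN : forall x y, Z x y N = y)
  (Zstep : forall x y i, (i < N)%N -> mdist (Z x y i) (Z x y i.+1) <= mdist x y / 2).

(** Level [k] goes from [a] to [b] in [N ^ k] steps; a point of the next level is the one at
    position [i %% N] in the chain that [Z] inserts into step [i %/ N]. *)
Fixpoint refine (k : nat) : nat -> X :=
  if k is k'.+1 then
    fun i => Z (refine k' (i %/ N)) (refine k' (i %/ N).+1) (i %% N)
  else fun i => if i is 0%N then a else b.

Let d := mdist a b.

Lemma refine_step k i : mdist (refine k i) (refine k i.+1) <= d / 2 ^+ k.
Proof.
elim: k i => [|k IHk] i.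
  by rewrite expr0 divr1; case: i => [//|i] /=; rewrite mdistxx mdist_ge0.
have H x y j : mdist x y <= d / 2 ^+ k -> (j < N)%N ->
    mdist (Z x y j) (Z x y j.+1) <= d / 2 ^+ k.+1.
  move=> xy jN; apply: le_trans (Zstep _ _ jN) _.
  by rewrite exprSr invfM mulrA ler_wpM2r.
rewrite /=; set q := (i %/ N)%N; set r := (i %% N)%N.
have rN : (r < N)%N by rewrite ltn_mod.
have iE : i.+1 = (q * N + r.+1)%N by rewrite addnS -divn_eq.
have [rN'|rN'] := ltnP r.+1 N.
  have -> : (i.+1 %/ N)%N = q by rewrite iE divnMDl// divn_small// addn0.
  have -> : (i.+1 %% N)%N = r.+1 by rewrite iE modnMDl modn_small.
  exact: H.
(* At the end of a block, the first point of the next block coincides with the last point of the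
   current chain. *)
have rE : r.+1 = N by apply/eqP; rewrite eqn_leq rN' rN.
have -> : (i.+1 %/ N)%N = q.+1 by rewrite iE rE divnMDl// divnn N0 addn1.
have -> : (i.+1 %% N)%N = 0%N by rewrite iE rE modnMDl modnn.
by rewrite Z0; have := H _ _ r (IHk q) rN; rewrite rE ZN.
Qed.

Lemma refine_parent k i :
  mdist (refine k.+1 i) (refine k (i %/ N)) <= N%:R * d / 2 ^+ k.+1.
Proof.
rewrite /= metric_sym -[X in mdist X](Z0 _ (refine k (i %/ N).+1)).
set x := refine k _; set y := refine k _.
have xy : mdist x y / 2 <= d / 2 ^+ k.+1.
  by rewrite exprSr invfM mulrA ler_wpM2r// refine_step.
have H j : (j <= N)%N -> mdist (Z x y 0) (Z x y j) <= j%:R * (d / 2 ^+ k.+1).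
  elim: j => [|j IHj] jN; first by rewrite mdistxx mul0r.
  apply: le_trans (metric_triangle _ (Z x y j) _) _.
  rewrite -natr1 mulrDl mul1r; apply: lerD; first exact/IHj/ltnW.
  exact: le_trans (Zstep _ _ jN) xy.
have rN : (i %% N <= N)%N by rewrite ltnW// ltn_mod.
apply: le_trans (H _ rN) _; rewrite -mulrA ler_wpM2r ?ler_nat//.
by rewrite divr_ge0 ?mdist_ge0// exprn_ge0.
Qed.

Lemma refine0 k : refine k 0%N = a.
Proof. by elim: k => //= k IHk; rewrite div0n mod0n Z0. Qed.

Lemma refineN k : refine k (N ^ k)%N = b.
Proof. by elim: k => //= k IHk; rewrite expnSr mulnK// modnMl Z0. Qed.

(** The level-[k] chain run through in unit time, with jumps at multiples of [1 / N ^ k]. As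
    [truncn] sends negative numbers to 0, the value is [a] at negative times. *)
Definition refine_fun k (t : R) : X := refine k (Num.truncn (t * N%:R ^+ k)).

Lemma refine_fun_parent k t :
  mdist (refine_fun k t) (refine_fun k.+1 t) <= N%:R * d / 2 ^+ k.+1.
Proof.
have N0' : 0 < N%:R :> R by rewrite ltr0n.
rewrite /refine_fun metric_sym.
(* The time intervals of level [k.+1] subdivide those of level [k], so the coarse index is the fine
   one divided by [N]. *)
suff <- : (Num.truncn (t * N%:R ^+ k.+1) %/ N)%N = Num.truncn (t * N%:R ^+ k).
  exact: refine_parent.
have [t0|t0] := ltP t 0.
  have E (j : nat) : Num.truncn (t * N%:R ^+ j) = 0%N.
    apply/eqP; rewrite -leqn0 truncn_le_nat (le_lt_trans _ ltr01)//.
    by rewrite mulr_le0_ge0 ?exprn_ge0// ltW.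
  by rewrite !E div0n.
have x0 : 0 <= t * N%:R ^+ k by rewrite mulr_ge0// exprn_ge0.
rewrite exprSr mulrA; move: (t * _) x0 => x x0.
have /andP[h1 h2] := truncn_itv (mulr_ge0 x0 (ltW N0')).
apply/esym/truncn_def; set n := Num.truncn (x * N%:R) in h1 h2 *.
rewrite -(ler_pM2r N0') -(ltr_pM2r N0') -!natrM; apply/andP; split.
  by apply: le_trans h1; rewrite ler_nat leq_trunc_div.
by apply: lt_le_trans h2 _; rewrite ler_nat ltn_ceil.
Qed.

Lemma refine_fun_close k (s t : R) : s <= t -> (t - s) * N%:R ^+ k < 1 ->
  mdist (refine_fun k s) (refine_fun k t) <= d / 2 ^+ k.
Proof.
rewrite mulrBl ltrBlDl => st; rewrite /refine_fun.
have : s * N%:R ^+ k <= t * N%:R ^+ k by rewrite ler_wpM2r// exprn_ge0.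
move: (s * _) (t * _) => x y xy yx.
have : (Num.truncn x <= Num.truncn y)%N by exact: le_truncn.
have : (Num.truncn y <= (Num.truncn x).+1)%N.
  rewrite truncn_le_nat; apply: lt_le_trans yx _.
  have [x0|x0] := ltP x 0.
    by rewrite -natr1 -natr1; have := ler0n R (Num.truncn x); lra.
  have /andP[_ h] := truncn_itv x0.
  by rewrite -natr1 lerD2r ltW.
rewrite leq_eqVlt => /predU1P[-> _|yx' xy']; first exact: refine_step.
have -> : Num.truncn x = Num.truncn y by apply/eqP; rewrite eqn_leq xy' -ltnS.
by rewrite mdistxx divr_ge0 ?mdist_ge0// exprn_ge0.
Qed.

(** The step functions converge uniformly and the jumps of the [k]-th one are at most [d / 2 ^ k],
    so the limit is continuous. It stays within [N d] of level 0, whose values are [a] and [b];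
    hence the factor [N + 1]. *)
Lemma refine_path : exists g : R -> X, [/\ continuous g, g 0 = a, g 1 = b &
  forall t, mdist a (g t) <= (N%:R + 1) * d].
Proof.
have d0 : 0 <= d by exact: mdist_ge0.
have Nd0 : 0 <= N%:R * d by rewrite mulr_ge0.
have /choice[g hg] t : exists l, forall k, mdist (refine_fun k t) l <= N%:R * d / 2 ^+ k.
  exact: geometric_cauchy_limit (refine_fun_parent ^~ t).
have limE t x : (forall k, refine_fun k t = x) -> g t = x.
  move=> tx; apply/esym/mdist_positivity/eqP; rewrite eq_le mdist_ge0 andbT.
  apply/ler_addgt0Pr => e e0; have [k ke] := exists_div_exp2_lt Nd0 e0.
  by rewrite add0r -(tx k); apply: le_trans (hg t k) (ltW ke).
exists g; split.
- apply/continuous_mdistP => t e e0.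
  (* The two approximation errors cost [N d / 2 ^ k] each, and one jump of the step function costs
     [d / 2 ^ k]. *)
  have c0 : 0 <= (2 * N%:R + 1) * d by rewrite mulr_ge0// addr_ge0// mulr_ge0.
  have [k ke] := exists_div_exp2_lt c0 e0.
  have Nk0 : 0 < N%:R ^+ k :> R by rewrite exprn_gt0// ltr0n.
  exists (N%:R ^+ k)^-1; first by rewrite invr_gt0.
  move=> s ts; apply: le_lt_trans ke.
  have H u v : u <= v -> `|u - v| < (N%:R ^+ k)^-1 ->
      mdist (g u) (g v) <= (2 * N%:R + 1) * d / 2 ^+ k.
    move=> uv; rewrite distrC ger0_norm ?subr_ge0// -[_^-1]mul1r ltr_pdivlMr// => uvk.
    have := refine_fun_close uv uvk; have := hg u k; have := hg v k.
    have := metric_triangle (g u) (refine_fun k u) (g v).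
    have := metric_triangle (refine_fun k u) (refine_fun k v) (g v).
    by rewrite (metric_sym (g u) (refine_fun k u)); set q := (2 ^+ k)^-1; lra.
  have [/H|/ltW/H] := leP t s; first exact.
  by rewrite metric_sym distrC; exact.
- by apply: limE => k; rewrite /refine_fun mul0r truncn0 refine0.
- by apply: limE => k; rewrite /refine_fun mul1r -natrX natrK refineN.
move=> t; have := hg t 0%N; rewrite expr0 divr1 => ht.
apply: le_trans (metric_triangle _ (refine_fun 0 t) _) _.
rewrite addrC mulrDl mul1r lerD//.
by rewrite /refine_fun /=; case: Num.truncn => [|n]; rewrite ?mdistxx.
Qed.

End refine.
End refinement.

(** * Properness *)

Lemma closure_mdistP (R : realType) (X : metricType R) (A : set X) (x : X) :
  closure A x <-> forall e, 0 < e -> exists2 y, A y & mdist x y < e.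
Proof.
split=> [Ax e e0|H B /nbhs_ballP[e /= e0 eB]].
  have [y [Ay]] := Ax _ (nbhsx_ballx x _ e0).
  by rewrite ballEmdist /= => xy; exists y.
have [y Ay xy] := H e e0; exists y; split => //; apply: eB.
by rewrite ballEmdist.
Qed.

Section properness.
Context {R : realType} {X : completeMetricType R}.
Variables (mu : {measure set (borel X) -> \bar R}).
Hypotheses (mu_ball : forall (a : X) (r : R), 0 < r -> (0 < mu (ball a r) < +oo)%E)
  (mu_doubling : doubling mu).

Lemma doubling_iter : exists2 D : R, 0 < D & forall n (x : X) (r : R), 0 < r ->
  (mu (ball x (2 ^+ n * r)) <= (D ^+ n)%:E * mu (ball x r))%E.
Proof.
have [D D0 hD] := mu_doubling; exists D => // n x r r0.
elim: n => [|n IHn]; first by rewrite !expr0 mul1r mul1e.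
rewrite exprS -mulrA; apply: le_trans (hD _ _ _) _; first by rewrite mulr_gt0// exprn_gt0.
by rewrite exprS EFinM -muleA lee_pmul2l.
Qed.

(* The balls of radius [e / 2] around separated points are disjoint, and doubling
   bounds their measures below. *)
Lemma separated_bounded (a : X) (r e : R) (z : nat -> X) : 0 < r -> 0 < e ->
  (forall n, ball a r (z n)) ->
  ~ (forall i n, (i < n)%N -> e <= mdist (z i) (z n)).
Proof.
move=> r0 e0 za sep.
have [D D0 hD] := doubling_iter.
have e20 : 0 < e / 2 by rewrite divr_gt0.
have re0 : 0 < r + e by rewrite addr_gt0.
have ere0 : 0 <= 2 * r + e by rewrite addr_ge0 ?mulr_ge0 ?ltW.
(* For this [n], enlarging the ball of radius [e / 2] around [z i] by the factor [2 ^ n] covers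
   [ball a (r + e)]. *)
have [n hn] := exists_div_exp2_lt ere0 e20.
have big i : (mu (ball a (r + e)) <= (D ^+ n)%:E * mu (ball (z i) (e / 2)))%E.
  apply: le_trans (hD n (z i) _ e20).
  apply: le_measure; rewrite ?inE; [exact: measurable_ball|exact: measurable_ball|].
  move=> y; rewrite !ballEmdist /= => ay.
  move: (za i); rewrite ballEmdist /= => azi.
  apply: le_lt_trans (metric_triangle _ a _) _.
  move: hn; rewrite ltr_pdivrMr ?exprn_gt0// mulrC (metric_sym _ a) => hn; lra.
have /andP[mu0 muoo] := mu_ball a re0.
pose F i : set X := ball (z i) (e / 2).
have mF i : measurable (F i : set (borel X)) by exact: measurable_ball.
have tF : trivIset setT F.
  apply: ltn_trivIset => i j ij; rewrite -subset0 => y [].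
  rewrite /F !ballEmdist /= => h1 h2; have := sep _ _ ij.
  have := metric_triangle (z j) y (z i); rewrite (metric_sym (z j) (z i)) (metric_sym y); lra.
have sub N : (\sum_(i < N) mu (F i) <= mu (ball a (r + e)))%E.
  rewrite -(@measure_semi_additive_ord_I _ _ _ mu F).
  - apply: le_measure; rewrite ?inE//.
    + exact: bigsetU_measurable.
    + exact: measurable_ball.
    move=> y; rewrite -bigcup_mkord => -[i _]; rewrite /F !ballEmdist /= => ziy.
    move: (za i); rewrite ballEmdist /= => azi.
    by apply: le_lt_trans (metric_triangle _ (z i) _) _; lra.
  - by [].
  - exact: sub_trivIset tF.
  - exact: bigsetU_measurable.
pose m := fine (mu (ball a (r + e))).
have mE : mu (ball a (r + e)) = m%:E by rewrite /m fineK// ge0_fin_numE// ltW.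
have m0 : 0 < m by rewrite -lte_fin -mE.
have Dn0 : 0 < D ^+ n by rewrite exprn_gt0.
(* More than [D ^ n] disjoint balls, each of measure at least [m / D ^ n], do not fit in a set of
   measure [m]. *)
pose N := (Num.bound (D ^+ n)).+1.
have lower : (((m / D ^+ n) *+ N)%:E <= \sum_(i < N) mu (F i))%E.
  rewrite -[X in X *+ _]mul1r.
  apply: (@le_trans _ _ (\sum_(i < N) (m / D ^+ n)%:E)%E).
    by rewrite sumEFin sumr_const card_ord mul1r.
  apply: lee_sum => i _; have := big i; rewrite mE -/(F i).
  by rewrite EFinM -lee_pdivrMl// muleC.
have := le_trans lower (sub N); rewrite mE lee_fin -mulr_natr.
rewrite mulrAC ler_pdivrMr// ler_pM2l// leNgt => /negP; apply.
apply: lt_trans (archi_boundP (ltW Dn0)) _.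
by rewrite ltr_nat.
Qed.

(** Total boundedness of [ball a r], in the form used by the Cauchy criterion. Otherwise [F]
    contains the complement of every ball of radius [e], and points of [ball a r] outside finitely
    many such balls can be picked forever. *)
Lemma ultra_small_ball (F : set_system X) (a : X) (r e : R) : UltraFilter F ->
  0 < r -> 0 < e -> F (ball a r) -> exists z, F (ball z e).
Proof.
move=> UF r0 e0 Fr; apply: contrapT => /forallNP nF.
have nF' z : F (~` ball z e) by have [/nF|//] := in_ultra_setVsetC (ball z e) UF.
have /choice[next hnext] : forall s : seq X, exists y,
    ball a r y /\ forall z, z \in s -> ~ ball z e y.
  move=> s; have : F (ball a r `&` [set y | forall z, z \in s -> ~ ball z e y]).
    apply: filterI => //; elim: s => [|z s IHs]; first exact: filterS filterT.
    apply: filterS2 (nF' z) IHs => y zy sy w; rewrite inE => /predU1P[->//|].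
    exact: sy.
  by move=> /filter_ex[y [? ?]]; exists y.
(* [l n] lists the first [n] points picked. *)
pose l := fix l n := if n is n'.+1 then next (l n') :: l n' else [::].
have lz i n : (i < n)%N -> next (l i) \in l n.
  elim: n => // n IHn; rewrite ltnS leq_eqVlt => /predU1P[->|/IHn] /=.
    by rewrite inE eqxx.
  by rewrite inE => ->; rewrite orbT.
apply: (@separated_bounded a r e (fun n => next (l n)) r0 e0).
  by move=> n; case: (hnext (l n)).
move=> i n /lz ln; case: (hnext (l n)) => _ /(_ _ ln).
by rewrite ballEmdist /= => /negP; rewrite -leNgt.
Qed.

(** Otherwise each [E k] has a point at distance at least [e] from [x]. An ultrafilter refining this
    sequence is Cauchy, so it converges; its limit lies in every [closure (E k)], hence is [x],
    although the points stay away from [x]. *)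
Lemma nested_impression_small (E : nat -> set X) (x a : X) (r e : R) :
  0 < r -> 0 < e -> (forall k, E k.+1 `<=` E k) -> E 0%N `<=` ball a r ->
  \bigcap_k closure (E k) `<=` [set x] -> exists k, E k `<=` ball x e.
Proof.
move=> r0 e0 dE Er Ex; apply: contrapT => /forallNP nE.
have /choice[y hy] : forall k, exists y, E k y /\ e <= mdist x y.
  move=> k; apply: contrapT => /forallNP ny; apply: (nE k) => y Ey.
  by rewrite ballEmdist /= ltNge; apply/negP => xy; apply: (ny y).
have decE k m : (k <= m)%N -> E m `<=` E k.
  elim: m => [|m IHm]; first by rewrite leqn0 => /eqP ->.
  rewrite leq_eqVlt => /predU1P[->//|]; rewrite ltnS => /IHm.
  exact: subset_trans.
have [G [UG sG]] := ultraFilterLemma (_ : ProperFilter (y @ \oo)).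
have GE k : G (E k).
  by apply: sG; exists k => // m /= km; apply: (decE _ _ km); case: (hy m).
have cG : cvg G.
  apply/cauchy_cvgP/cauchyP => d d0.
  exact: (ultra_small_ball UG r0 d0 (filterS Er (GE 0%N))).
have lE k : closure (E k) (lim G).
  move=> B /cG GB; exact: (filter_ex (filterI (GE k) GB)).
have /Ex lx : (\bigcap_k closure (E k)) (lim G) by move=> k _; exact: lE.
have Ge : G [set z | e <= mdist x z].
  by apply: sG; exists 0%N => // m _; case: (hy m).
have /cG GB := nbhsx_ballx (lim G) e e0.
have [z [/= xz]] := filter_ex (filterI Ge GB).
by rewrite lx ballEmdist /= ltNge xz.
Qed.

End properness.

(** * Paths and ends *)

Section paths.
Context {R : realType} {X : metricType R}.
Implicit Types (V : set X) (a b c : X).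

Lemma continuous_glue (f g : R -> X) (s : R) : continuous f -> continuous g ->
  f s = g s -> continuous (fun t => if t <= s then f t else g t).
Proof.
move=> /continuous_mdistP cf /continuous_mdistP cg fgs.
apply/continuous_mdistP => t e e0.
have [d1 d10 h1] := cf t e e0; have [d2 d20 h2] := cg t e e0.
have [ts|st|ts] := ltgtP t s.
- exists (Num.min d1 (s - t)); first by rewrite lt_min d10 subr_gt0.
  move=> u; rewrite lt_min => /andP[ud us]; rewrite ifT; last first.
    by move: us; rewrite distrC => /(le_lt_trans (ler_norm _)); lra.
  exact: h1.
- exists (Num.min d2 (t - s)); first by rewrite lt_min d20 subr_gt0.
  move=> u; rewrite lt_min => /andP[ud us]; rewrite ifF; last first.
    by apply/negbTE; rewrite -ltNge; move: us => /(le_lt_trans (ler_norm _)); lra.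
  exact: h2.
exists (Num.min d1 d2); first by rewrite lt_min d10.
move=> u; rewrite lt_min => /andP[ud1 ud2]; case: ifP => _; first exact: h1.
by rewrite ts fgs -ts; exact: h2.
Qed.

Definition path_in V a b := exists g : R -> X,
  [/\ continuous g, g 0 = a, g 1 = b & forall t, 0 <= t <= 1 -> V (g t)].

Lemma continuous_affine (k m : R) : continuous (fun t : R => k * t + m).
Proof.
move=> t; apply: cvgD; last exact: cvg_cst.
by apply: cvgM; [exact: cvg_cst|exact: cvg_id].
Qed.

Lemma continuous_comp_affine (f : R -> X) (k m : R) : continuous f ->
  continuous (fun t => f (k * t + m)).
Proof.
move=> cf t.
apply: (@cvg_comp _ _ _ (fun t => k * t + m) f _ (nbhs (k * t + m))); last exact: cf.
exact: continuous_affine.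
Qed.

Lemma path_in_trans V a b c : path_in V a b -> path_in V b c -> path_in V a c.
Proof.
move=> [f [cf f0 f1 fV]] [g [cg g0 g1 gV]].
exists (fun t => if t <= 2^-1 then f (2 * t + 0) else g (2 * t + (-1))); split.
- apply: continuous_glue.
  + exact: continuous_comp_affine.
  + exact: continuous_comp_affine.
  + by rewrite mulfV// addr0 subrr f1 g0.
- by rewrite invr_ge0 ler0n mulr0 addr0.
- rewrite ifF ?mulr1; last by apply/negbTE; rewrite -ltNge invf_lt1// ltr1n.
  by rewrite (_ : 2 + -1 = 1)//; lra.
move=> t /andP[t0 t1]; case: leP => t2.
  by apply: fV; apply/andP; split; lra.
by apply: gV; apply/andP; split; lra.
Qed.

Lemma path_in_connected V a b : path_in V a b ->
  exists A, [/\ connected A, A `<=` V, A a & A b].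
Proof.
move=> [g [cg g0 g1 gV]]; exists (g @` `[0, 1]); split.
- apply: connected_continuous_connected; first exact: segment_connected.
  exact: continuous_subspaceT.
- by move=> _ [t /= + <-]; rewrite in_itv/= => /gV.
- by exists 0 => //=; rewrite in_itv/= lexx ler01.
- by exists 1 => //=; rewrite in_itv/= lexx ler01.
Qed.

(* The paths [h k] run in the unit intervals [k, k + 1]; [0, 1[ is mapped onto
   [0, +oo[ by [t / (1 - t)]. *)
Lemma infinite_concatenation (h : nat -> R -> X) (x : X) (E : nat -> set X) :
  (forall k, continuous (h k)) -> (forall k, h k 1 = h k.+1 0) ->
  (forall k t, 0 <= t <= 1 -> E k (h k t)) ->
  (forall e, 0 < e -> exists K, forall k, (K <= k)%N -> E k `<=` ball x e) ->
  exists g : R -> X, [/\ {within `[0, 1], continuous g}, g 1 = x &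
    forall t, 0 <= t < 1 -> exists k, E k (g t)].
Proof.
move=> ch h1 hE Ex.
(* [G n] follows [h 0], ..., [h n.-1] in turn. The limit [g] agrees with [G n] on []-oo, n]], which
   gives its continuity. *)
pose G := fix G n : R -> X := if n is m.+1 then
  fun t => if t <= m%:R then G m t else h m (1 * t - m%:R) else fun=> h 0%N 0.
have Gn n : G n n%:R = h n 0.
  elim: n => [//|n IHn] /=; rewrite ler_nat ltnn mul1r -natr1 addrAC subrr add0r.
  exact: h1.
have cG n : continuous (G n).
  elim: n => [|n IHn] /=; first by move=> t; exact: cvg_cst.
  apply: continuous_glue => //; last by rewrite mul1r subrr Gn.
  exact: continuous_comp_affine.
have Gle n m t : (n <= m)%N -> t <= n%:R -> G m t = G n t.
  move=> nm tn; elim: m nm => [|m IHm]; first by rewrite leqn0 => /eqP ->.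
  rewrite leq_eqVlt => /predU1P[<-//|]; rewrite ltnS => nm /=.
  by rewrite ifT ?IHm// (le_trans tn)// ler_nat.
pose g t := G (Num.truncn t).+1 t.
have gG n t : t <= n%:R -> g t = G n t.
  move=> tn; rewrite /g; have [t0|t0] := leP 0 t; last first.
    rewrite (Gle 0%N) ?(Gle 0%N n)//; exact: ltW.
  have /andP[_ /ltW tt] := truncn_itv t0.
  have [nt|tn'] := leqP n (Num.truncn t).+1; first by rewrite (Gle n).
  by rewrite (Gle (Num.truncn t).+1 n)// ltnW.
have cg : continuous g.
  move=> t; have [n tn] : exists n : nat, t < n%:R.
    exists (Num.bound `|t|); exact: le_lt_trans (ler_norm _) (archi_boundP (normr_ge0 _)).
  have : {near t, G n =1 g}.
    near=> u; apply/esym/gG/ltW; near: u.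
    exact: lt_nbhsl.
  move=> /near_eq_cvg H; have Hc : g @ t --> G n t.
    by apply: cvg_trans H _; exact: cG.
  by rewrite /continuous_at (gG n t (ltW tn)).
have gE t : 0 <= t -> E (Num.truncn t) (g t).
  move=> t0; have /andP[kt tk] := truncn_itv t0.
  rewrite /g /=; case: leP => [tk'|kt'].
    have -> : t = (Num.truncn t)%:R by apply/eqP; rewrite eq_le tk' kt.
    by rewrite natrK Gn; apply: hE; rewrite lexx ler01.
  by apply: hE; rewrite mul1r subr_ge0 kt lerBlDl natr1 ltW.
pose phi (t : R) := t / (1 - t).
have phi0 t : 0 <= t < 1 -> 0 <= phi t by move=> /andP[? ?]; rewrite divr_ge0//; lra.
exists (fun t => if t < 1 then g (phi t) else x); split.
- apply/within_continuous_mdistP => t e /=; rewrite in_itv/= => /andP[t0 t1] e0.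
  have [{}t1|t1'] := ltP t 1; last first.
    have [K hK] := Ex e e0.
    have K0 : 0 < K%:R + 1 :> R by rewrite natr1 ltr0n.
    (* For [u < 1], [phi u = 1 / (1 - u) - 1] exceeds [K] once [1 - u < 1 / (K + 1)], and then
       [g (phi u)] lies in some [E k] with [k >= K]. *)
    exists (K%:R + 1)^-1 => [|u]; first by rewrite invr_gt0.
    rewrite in_itv/= => /andP[u0 u1] tu.
    have {}tu : 1 - u < (K%:R + 1)^-1.
      by apply: le_lt_trans tu; apply: le_trans (ler_norm _); lra.
    case: (ltP u 1) => [{}u1|]; last by rewrite mdistxx.
    have u01 : 0 <= u < 1 by rewrite u0.
    suff /hK/(_ _ (gE _ (phi0 u u01))) : (K <= Num.truncn (phi u))%N.
      by rewrite ballEmdist.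
    have /andP[_ pu] := truncn_itv (phi0 u u01).
    rewrite -ltnS -(ltr_nat R); apply: le_lt_trans pu.
    rewrite /phi ler_pdivlMr ?subr_gt0//.
    move: tu; rewrite -[_^-1]mul1r ltr_pdivlMr//; lra.
  have cphi : phi u @[u --> t] --> phi t.
    apply: cvgM; first exact: cvg_id.
    apply: cvgV; first by rewrite subr_eq0 gt_eqF.
    by apply: cvgB; [exact: cvg_cst|exact: cvg_id].
  have : g (phi u) @[u --> t] --> g (phi t).
    by apply: (@cvg_comp _ _ _ phi g _ (nbhs (phi t))); [exact: cphi|exact: cg].
  move=> /metricType_numDomainType.cvgrPdist_lt/(_ _ e0)/nbhs_ballP[d /= d0 hd].
  exists (Num.min d (1 - t)); first by rewrite lt_min d0 subr_gt0.
  move=> u _; rewrite lt_min => /andP[ud]; rewrite distrC => ut.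
  rewrite ifT; first exact: hd.
  have := le_lt_trans (ler_norm _) ut; lra.
- by rewrite ltxx.
move=> t /andP[t0 t1]; rewrite t1; exists (Num.truncn (phi t)).
by apply/gE/phi0; rewrite t0.
Unshelve. all: by end_near.
Qed.
End paths.

(** * Connected sets, prime ends and accessible points *)

Section ends.
Context {R : realType} {X : metricType R}.
Implicit Types (V A C Omega : set X) (E F : nat -> set X).

(** Without a boundary point in [C], the trace of [A] on [C] would be both open and closed in
    [C]. *)
Lemma connected_meets_boundary C A : connected C -> C `&` A !=set0 ->
  ~ C `<=` A -> C `&` boundary A !=set0.
Proof.
move=> cC [a [Ca Aa]] CA; apply: contrapT => nB; apply: CA.
have bA y : C y -> closure A y -> A° y.
  move=> Cy Ay; apply: contrapT => nAy; apply: nB; exists y; split => //.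
have E : C `&` A° = C.
  apply: cC.
  - by exists a; split => //; apply: bA => //; exact: subset_closure.
  - by exists A°; [exact: open_interior|].
  - exists (closure A); first exact: closed_closure.
    apply/seteqP; split => y [Cy]; last by move/(bA _ Cy).
    by move/interior_subset/subset_closure.
by move=> y; rewrite -E => -[_ /interior_subset].
Qed.

Lemma dist_le A C (a c : X) : A a -> C c -> (dist A C <= (mdist a c)%:E)%E.
Proof. by move=> Aa Cc; apply: ereal_inf_lbound; exists a => //; exists c. Qed.

Lemma chain_dividesT E F (G : nat -> set X) :
  chain_divides E F -> chain_divides F G -> chain_divides E G.
Proof.
move=> EF FG k; have [l FlGk] := FG k; have [m EmFl] := EF l.
by exists m; exact: subset_trans FlGk.
Qed.

Lemma chain_dividesxx E : chain_divides E E.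
Proof. by move=> k; exists k. Qed.

Lemma chain_nonincreasing Omega E k m : chain Omega E -> (k <= m)%N -> E m `<=` E k.
Proof.
move=> [_ dE _ _] km; rewrite -(subnKC km); elim: (m - k)%N => [|n IHn].
  by rewrite addn0.
by rewrite addnS; exact: subset_trans IHn.
Qed.

Lemma chain_nonempty Omega E k : chain Omega E -> E k !=set0.
Proof.
move=> [aE _ _ _]; case: (aE k) => _ _ _ [y [/closure_mdistP yE _]].
by have [z ? _] := yE 1 ltr01; exists z.
Qed.

(* If no [E l] were contained in [F k], the connected sets [E l] would meet the
   boundaries of both [F k] and [F k.+1], whose distance is positive. *)
Lemma small_chain_divides Omega E F (x : X) : chain Omega E -> chain Omega F ->
  (forall e, 0 < e -> exists k, E k `<=` ball x e) ->
  chain_divides F E -> chain_divides E F.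
Proof.
move=> chE chF small FE k; apply: contrapT => /forallNP nEF.
case: (chF) => _ dF sepF _.
have [d d0 hd] : exists2 d : R, 0 < d &
    (d%:E <= dist (Omega `&` boundary (F k.+1)) (Omega `&` boundary (F k)))%E.
  have := sepF k; case: (dist _ _) => [r| |] // r0.
    by exists r.
  by exists 1; rewrite // leey.
have d20 : 0 < d / 2 by rewrite divr_gt0.
have [l El] := small _ d20.
have [cE EO] : connected (E l) /\ E l `<=` Omega.
  by case: chE => /(_ l)[_ ? [? _] _].
have [m Fm] := FE l.
(* The index is large enough for [y] to lie in [F m], hence in [E l], and also in [F k.+1]. *)
have [y Fy] := chain_nonempty (maxn m k.+1) chF.
have Ey : E l y by apply: Fm; exact: (chain_nonincreasing chF (leq_maxl _ _) Fy).
have Fky : F k.+1 y by exact: (chain_nonincreasing chF (leq_maxr _ _) Fy).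
have [q [Eq bq]] := connected_meets_boundary cE
  (ex_intro _ y (conj Ey (dF k _ Fky))) (nEF l).
have [|p [Ep bp]] := connected_meets_boundary cE (ex_intro _ y (conj Ey Fky)).
  by move=> H; apply: (nEF l) => z /H/dF.
have := le_trans hd (dist_le (conj (EO _ Ep) bp) (conj (EO _ Eq) bq)).
rewrite lee_fin; move: (El _ Ep) (El _ Eq); rewrite !ballEmdist /= => xp xq.
by have := metric_triangle p x q; rewrite (metric_sym p x); lra.
Qed.

Lemma end_of_equiv Omega E F : chain_equiv E F -> end_of Omega E = end_of Omega F.
Proof.
move=> [EF FE]; apply/seteqP; split=> G [chG [h1 h2]]; split => //.
  by split; [exact: chain_dividesT h1|exact: chain_dividesT EF].
by split; [exact: chain_dividesT h1|exact: chain_dividesT FE].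
Qed.

(** By [small_chain_divides], a chain that divides [E] is divided by [E] in turn. *)
Lemma small_chain_prime Omega E (x : X) : chain Omega E ->
  (forall e, 0 < e -> exists k, E k `<=` ball x e) ->
  is_prime_end Omega (end_of Omega E).
Proof.
move=> chE small; split; first by exists E.
move=> _ [F0 chF0 ->] [F [chF [F0F FF0]] [E' [chE' [EE' E'E]] FE']].
have FE : chain_divides F E by exact: chain_dividesT E'E.
have EF := small_chain_divides chE chF small FE.
apply: end_of_equiv; split; first exact: chain_dividesT FE.
exact: chain_dividesT FF0.
Qed.

Lemma small_end_impression Omega E (x : X) : chain Omega E ->
  (forall e, 0 < e -> exists k, E k `<=` ball x e) -> impression E x ->
  end_impression (end_of Omega E) = [set x].
Proof.
move=> chE small Ex; apply/seteqP; split=> [y [F [chF [EF FE]] Fy]|_ ->]; last first.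
  by exists E => //; split => //; split; exact: chain_dividesxx.
apply/esym/mdist_positivity/eqP; rewrite eq_le mdist_ge0 andbT.
apply/ler_addgt0Pr => e e0; rewrite add0r.
have e20 : 0 < e / 2 by rewrite divr_gt0.
have [k Ek] := small _ e20; have [l Fl] := FE k.
have /closure_mdistP/(_ _ e20)[z /Fl/Ek + yz] := Fy l Logic.I.
rewrite ballEmdist /= => xz.
by have := metric_triangle x z y; rewrite (metric_sym z y); lra.
Qed.

(** A point of [E k.+1] not interior to [E k] would lie on the boundaries of both sets, whose
    distance would then be zero. *)
Lemma chain_interior Omega E k : chain Omega E -> E k.+1 `<=` (E k)°.
Proof.
move=> [aE dE sep _] y Ey; apply: contrapT => nEy.
have [_ _ [EO _] _] := aE k.
have Oy : Omega y by apply/EO/dE.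
have := sep k; rewrite ltNge => /negP; apply.
apply: (@le_trans _ _ (mdist y y)%:E); last by rewrite mdistxx.
apply: dist_le; split => //.
  split; first exact: subset_closure.
  by move=> H; apply: nEy; exact: interiorS (dE k) _ H.
by split => //; apply/subset_closure/dE.
Qed.

Section locally_connected.
Variables (M : R).
Hypotheses (M0 : 0 < M) (quasi : forall a b : X, exists g : R -> X,
  [/\ continuous g, g 0 = a, g 1 = b & forall t, mdist a (g t) <= M * mdist a b]).

Lemma path_in_near V (a : X) : open V -> V a -> exists2 d, 0 < d &
  forall b c, mdist a b < d -> mdist a c < d -> path_in V b c.
Proof.
rewrite openE => oV /oV /nbhs_ballP[r /= r0 rV].
have M20 : 0 < 2 * M + 1 by rewrite addr_gt0// mulr_gt0.
(* The path stays within [2 M q] of [b], and [b] is within [q] of [a]. *)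
pose q := r / (2 * M + 1).
have rq : r = (2 * M + 1) * q by rewrite /q mulrC divfK// gt_eqF.
exists q => [|b c ab ac]; first by rewrite divr_gt0.
have [g [cg g0 g1 hg]] := quasi b c; exists g; split => // t _.
apply: rV; rewrite ballEmdist /=.
have h1 := metric_triangle a b (g t); have h2 := hg t.
have h3 : mdist b c <= mdist a b + mdist a c.
  by rewrite (metric_sym a b); exact: metric_triangle.
have h4 : M * mdist b c <= M * (mdist a b + mdist a c) by rewrite ler_pM2l.
have h5 : M * mdist a b < M * q by rewrite ltr_pM2l.
have h6 : M * mdist a c < M * q by rewrite ltr_pM2l.
by rewrite rq; lra.
Qed.

(** By [path_in_near], the points of [V] joined to [a] and those not joined to [a] form two open
    sets, and [C] cannot meet both. *)
Lemma connected_path_in V C (a b : X) : open V -> connected C -> C `<=` V ->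
  C a -> C b -> path_in V a b.
Proof.
move=> oV cC CV Ca Cb.
pose P := [set y | V y /\ path_in V a y].
pose N := [set y | V y /\ ~ path_in V a y].
have near0 (d : R) (y : X) : 0 < d -> mdist y y < d by rewrite mdistxx.
have oP : open P.
  rewrite openE => y [Vy ay]; apply/nbhs_ballP.
  have [d d0 hd] := path_in_near oV Vy.
  exists d => // z; rewrite ballEmdist /= => yz; split.
    have [g [_ _ <- gV]] := hd y z (near0 d y d0) yz.
    by apply: gV; rewrite ler01 lexx.
  by apply: path_in_trans ay (hd _ _ _ yz); rewrite mdistxx.
have oN : open N.
  rewrite openE => y [Vy ay]; apply/nbhs_ballP.
  have [d d0 hd] := path_in_near oV Vy.
  exists d => // z; rewrite ballEmdist /= => yz; split.
    have [g [_ _ <- gV]] := hd y z (near0 d y d0) yz.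
    by apply: gV; rewrite ler01 lexx.
  move=> az; apply: ay; apply: path_in_trans az (hd _ _ yz _).
  by rewrite mdistxx.
have aa : path_in V a a.
  have [d d0 hd] := path_in_near oV (CV _ Ca).
  by apply: hd; rewrite mdistxx.
suff E : C `&` P = C by move: Cb; rewrite -E => -[_ []].
apply: cC.
- by exists a; split => //; split => //; exact: CV.
- by exists P.
- exists (~` N); first exact: open_closedC.
  apply/seteqP; split => y [Cy]; first by move=> [_ ?]; split => // -[].
  move=> nN; split => //; split; first exact: CV.
  by apply: contrapT => nP; apply: nN; split => //; exact: CV.
Qed.

(** By local path connectedness, a point of the component close to [y] is joined within [V] to every
    point near [y]. *)
Lemma component_interior V (y z : X) : open V -> V y ->
  closure (connected_component V z) y -> (connected_component V z)° y.
Proof.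
move=> oV Vy /closure_mdistP cl.
have [d d0 hd] := path_in_near oV Vy.
have [w zw yw] := cl d d0.
apply/nbhs_ballP; exists d => // v; rewrite ballEmdist /= => yv.
have [A [cA AV Aw Av]] := path_in_connected (hd _ _ yw yv).
apply: connected_component_trans zw _.
by exists A.
Qed.

(** Inside the ball, [component_interior] makes every point of [Omega] in the closure of the
    component an interior point. This yields the separation required of a chain. *)
Lemma component_boundary Omega (x z y : X) (r : R) : open Omega ->
  (Omega `&` boundary (connected_component (Omega `&` ball x r) z)) y ->
  r <= mdist x y.
Proof.
move=> oO [Oy [cl nint]]; rewrite leNgt; apply/negP => xy; apply: nint.
apply: component_interior => //; last by split => //; rewrite ballEmdist.
apply: openI => //; rewrite openE => u; rewrite /= ballEmdist /= => xu.
apply/nbhs_ballP; exists (r - mdist x u); first by rewrite /= subr_gt0.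
move=> v; rewrite !ballEmdist /= => uv.
by have := metric_triangle x u v; lra.
Qed.

(** [E k] is the component of [Omega] in [ball x (r k)] that contains the tail of the curve. Inside
    [Omega], its boundary has distance at least [r k] from [x], while that of [E k.+1] has distance
    at most [r k.+1]. *)
Lemma accessible_chain Omega (x : X) : bounded_domain Omega ->
  boundary Omega x -> accessible Omega x ->
  exists E (r : R), [/\ chain Omega E, 0 < r,
    forall k, E k `<=` ball x (r / 2 ^+ k) & impression E x].
Proof.
move=> [oO cO [w Ow] bO] [clOx niOx] [g [cg g1 gO]].
have nOx : ~ Omega x by move=> Ox; apply: niOx; rewrite (interior_id _).1.
have xw : 0 < mdist x w by rewrite mdist_gt0; apply/eqP => xw; apply: nOx; rewrite xw.
(* The point [w] of [Omega] is at distance [r 0] from [x], so no [E k] contains it and all are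
   proper subsets of [Omega]. *)
pose r k := mdist x w / 2 ^+ k.
have r0 k : 0 < r k by rewrite divr_gt0// exprn_gt0.
have rS k : r k.+1 < r k.
  rewrite /r ltr_pM2l// ltf_pV2 ?posrE ?exprn_gt0//.
  by rewrite exprS ltr_pMl ?exprn_gt0// ltr1n.
have /choice[s hs] k : exists s, 0 <= s < 1 /\ forall t, s <= t < 1 -> ball x (r k) (g t).
  have /within_continuous_mdistP/(_ 1 (r k)) := cg.
  rewrite /= in_itv/= ler01 lexx => /(_ isT (r0 k))[d d0 hd].
  exists (Num.max 0 (1 - d / 2)); split.
    by rewrite le_max lexx gt_max ltr01/=; lra.
  move=> t; rewrite ge_max => /andP[/andP[t0 td] t1].
  rewrite ballEmdist /= -g1; apply: hd; first by rewrite in_itv/= t0 ltW.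
  by rewrite ger0_norm; lra.
have s01 k : 0 <= s k < 1 by case: (hs k).
pose V k := Omega `&` ball x (r k).
have gV k t : s k <= t < 1 -> V k (g t).
  move=> tk; split; last by case: (hs k) => _; apply.
  by apply: gO; move: (s01 k) tk => /andP[? ?] /andP[? ?]; apply/andP; split; lra.
pose E k := connected_component (V k) (g (s k)).
have tail k t : s k <= t < 1 -> E k (g t).
  move=> tk; exists (g @` `[s k, t]); last first.
    by exists t => //=; rewrite in_itv/= lexx andbT; case/andP: tk.
  split.
  - by exists (s k) => //=; rewrite in_itv/= lexx; case/andP: tk.
  - move=> _ [u /= + <-]; rewrite in_itv/= => /andP[su ut]; apply: gV.
    by rewrite su (le_lt_trans ut)//; case/andP: tk.
  apply: connected_continuous_connected; first exact: segment_connected.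
  apply: continuous_subspaceW cg => u /=; rewrite !in_itv/=.
  by move: (s01 k) tk => /andP[? ?] /andP[? ?] /andP[? ?]; apply/andP; split; lra.
have EV k : E k `<=` V k by exact: connected_component_sub.
have Eb k : E k `<=` ball x (r k) by move=> y /EV[].
have EO k : E k `<=` Omega by move=> y /EV[].
(* Past both [s k] and [s k.+1] the curve lies in both components. *)
have dE k : E k.+1 `<=` E k.
  pose t := Num.max (s k) (s k.+1).
  have tk : s k <= t < 1.
    by rewrite le_max lexx gt_max; case/andP: (s01 k) => _ ->; case/andP: (s01 k.+1).
  have tk1 : s k.+1 <= t < 1.
    by rewrite le_max lexx orbT gt_max; case/andP: (s01 k) => _ ->; case/andP: (s01 k.+1).
  rewrite /E (same_connected_component (tail _ _ tk)).
  apply: connected_component_max; first exact: tail tk1.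
    move=> y /EV[Oy]; rewrite ballEmdist /= => xy; split => //.
    by rewrite ballEmdist /=; exact: lt_trans xy (rS k).
  exact: component_connected.
have Ex k : closure (E k) x.
  apply/closure_mdistP => e e0.
  have [n hn] := exists_div_exp2_lt (ltW xw) e0.
  pose t := Num.max (s k) (s n).
  exists (g t).
    by apply: tail; rewrite le_max lexx gt_max; case/andP: (s01 k) => _ ->; case/andP: (s01 n).
  have [_] : V n (g t).
    by apply: gV; rewrite le_max lexx orbT gt_max; case/andP: (s01 k) => _ ->; case/andP: (s01 n).
  by rewrite ballEmdist /= => /lt_trans; apply.
exists E, (mdist x w); split => //.
split => //.
- move=> k; split.
  + apply: le_lt_trans (_ : ((r k + r k)%:E < +oo)%E); last by rewrite ltry.
    apply: ge_ereal_sup => _ [y /Eb + [z /Eb + <-]]; rewrite !ballEmdist /= => xy xz.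
    by rewrite lee_fin; have := metric_triangle y x z; rewrite (metric_sym y x); lra.
  + exact: component_connected.
  + split; first exact: EO.
    move=> /(_ w Ow)/Eb; rewrite ballEmdist /= ltNge => /negP; apply.
    by rewrite /r ler_pdivrMr ?exprn_gt0// ler_peMr ?(ltW xw)// exprn_ege1// ler1n.
  + by exists x; split => //; split.
- move=> k; apply: (@lt_le_trans _ _ (r k - r k.+1)%:E).
    by rewrite lte_fin subr_gt0.
  apply: le_ereal_inf_tmp => _ [y [Oy [cly _]] [z zb <-]].
  have xz := component_boundary oO zb.
  have xy : mdist x y <= r k.+1.
    apply/ler_addgt0Pr => e e0; have /closure_mdistP/(_ e e0)[u /Eb + yu] := cly.
    rewrite ballEmdist /= => xu.
    by have := metric_triangle x u y; rewrite (metric_sym u y); lra.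
  by rewrite lee_fin; have := metric_triangle x y z; lra.
- move=> y Ey; suff -> : y = x by split.
  apply/esym/mdist_positivity/eqP; rewrite eq_le mdist_ge0 andbT.
  apply/ler_addgt0Pr => e e0; rewrite add0r.
  have e20 : 0 < e / 2 by rewrite divr_gt0.
  have [n hn] := exists_div_exp2_lt (ltW xw) e20.
  have /closure_mdistP/(_ _ e20)[u /Eb + yu] := Ey n Logic.I.
  rewrite ballEmdist /= -/(r n) in hn * => xu.
  by have := metric_triangle x u y; rewrite (metric_sym u y); lra.
Qed.

(** Two points of the connected set [E k.+1] are joined by a path in the open set [(E k)°]; these
    paths are concatenated. *)
Lemma chain_accessible Omega E (x : X) : chain Omega E ->
  (forall e, 0 < e -> exists k, E k `<=` ball x e) -> accessible Omega x.
Proof.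
move=> chE small.
have /choice[y hy] : forall k, exists y, E k y by move=> k; exact: chain_nonempty chE.
have /choice[h hh] : forall k, exists h : R -> X,
    [/\ continuous h, h 0 = y k.+1, h 1 = y k.+2 & forall t, 0 <= t <= 1 -> (E k)° (h t)].
  move=> k; apply: (@connected_path_in _ (E k.+1)).
  - exact: open_interior.
  - by case: chE => /(_ k.+1)[].
  - exact: chain_interior chE.
  - exact: hy.
  - by case: chE => _ dE _ _; exact: dE.
have [|k|k t t01|e e0|g [cg g1 gE]] := @infinite_concatenation R X h x E.
- by move=> k; case: (hh k).
- by case: (hh k) => _ _ -> _; case: (hh k.+1).
- by apply: interior_subset; case: (hh k) => _ _ _; apply.
- have [K hK] := small e e0; exists K => k /(chain_nonincreasing chE) EK.
  exact: subset_trans EK hK.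
exists g; split => // t /gE[k].
by case: chE => /(_ k)[_ _ [+ _] _] _ _ _; apply.
Qed.

End locally_connected.
End ends.

(** * Modulus of annuli *)

Section annuli.
Context {R : realType} {X : completeMetricType R}.
Variables (mu : {measure set (borel X) -> \bar R}) (p : R) (x : X).
Hypotheses (p_gt0 : 0 < p).
Local Notation lebesgue := (@lebesgue_measure R).

Lemma modulus_ge0 (G : set (R * (R -> X))) : (0 <= modulus mu p G)%E.
Proof.
apply: le_ereal_inf_tmp => _ [rho _ <-].
by apply: integral_ge0 => y _; exact: poweR_ge0.
Qed.

Definition annulus (r s : R) : set X := [set y | r < mdist x y < s].

Lemma measurable_annulus r s : measurable (annulus r s : set (borel X)).
Proof.
apply: sub_sigma_algebra; rewrite openE => y /= /andP[ry ys].
apply/nbhs_ballP; exists (Num.min (mdist x y - r) (s - mdist x y)).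
  by rewrite /= lt_min !subr_gt0 ry.
move=> z; rewrite ballEmdist /= lt_min => /andP[zr zs].
have := metric_triangle x z y; have := metric_triangle x y z.
rewrite (metric_sym z y) => h1 h2; apply/andP; split; lra.
Qed.

(* [\sum_j a_j 1_{A_j}] over disjoint annuli [A_j], each of which a curve from the
   smallest ball to outside the largest one crosses in time at least its width. *)
Lemma modulus_annuli (G : set (R * (R -> X))) (N : nat) (s a : nat -> R) :
  (forall j, s j.+1 < s j) -> (forall j, 0 <= a j) ->
  (forall c, G c -> [/\ arclength_curve c, mdist x (c.2 0) <= s N &
     s 0%N <= mdist x (c.2 c.1)]) ->
  1 <= \sum_(j < N) a j * (s j - s j.+1) ->
  (modulus mu p G <= \sum_(j < N) (a j `^ p)%:E * mu (ball x (s j)))%E.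
Proof.
move=> sdec a0 hG a1.
pose A j := annulus (s j.+1) (s j).
have mA j : measurable (A j : set (borel X)) by exact: measurable_annulus.
have sle i j : (i <= j)%N -> s j <= s i.
  move=> ij; rewrite -(subnKC ij); elim: (j - i)%N => [|n IHn]; first by rewrite addn0.
  by rewrite addnS; apply: le_trans IHn; exact: ltW.
pose rho y : \bar R := (\sum_(j < N) a j * \1_(A j) y)%:E.
have rhoE y : rho y = (\sum_(j < N) (a j)%:E * (\1_(A j) y)%:E)%E.
  by rewrite /rho -sumEFin; apply: eq_bigr => j _; rewrite EFinM.
have m1 j : measurable_fun setT ((fun y => (\1_(A j) y)%:E) : borel X -> \bar R).
  by case: (indic_nonneg_borel (mA j)).
have brho : nonneg_borel rho.
  split; last by move=> y; rewrite lee_fin sumr_ge0// => j _; rewrite mulr_ge0.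
  rewrite (_ : rho = fun y => (\sum_(j < N) (a j)%:E * (\1_(A j) y)%:E)%E); last exact/funext.
  by apply: emeasurable_sum => j; exact: measurable_funeM.
apply: (@le_trans _ _ (ppower_integral mu p rho)).
  apply: ereal_inf_lbound; exists rho => //; split => // c Gc.
  have [arc c0 cl] := hG c Gc.
  have lf t u : `|mdist x (clamped c t) - mdist x (clamped c u)| <= `|t - u|.
    apply: le_trans (clamped_lipschitz arc t u).
    have := metric_triangle x (clamped c t) (clamped c u).
    have := metric_triangle x (clamped c u) (clamped c t).
    rewrite (metric_sym (clamped c u)) => ? ?.
    by apply/ler_normlP; split; lra.
  rewrite line_integral_clamped.
  under eq_integral do rewrite rhoE.
  rewrite ge0_integral_sum//; last 2 first.
  - move=> j; apply: measurable_funeM; apply: measurable_funTS.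
    exact: measurable_comp_clamped arc (indic_nonneg_borel (mA j)).
  - by move=> j t _; rewrite mule_ge0// lee_fin.
  apply: (@le_trans _ _ (\sum_(j < N) (a j * (s j - s j.+1))%:E)%E).
    by rewrite sumEFin lee_fin.
  apply: lee_sum => j _; rewrite ge0_integralZl//; last 2 first.
  - apply: measurable_funTS.
    exact: measurable_comp_clamped arc (indic_nonneg_borel (mA j)).
  - by rewrite lee_fin.
  rewrite EFinM lee_wpmul2l ?lee_fin//.
  rewrite -(line_integral_clamped c (fun y => (\1_(A j) y)%:E)).
  apply: (@line_integral_crossing _ _ c (mdist x)) => //.
  - by apply: le_trans c0 _; exact: sle.
  - exact: ltW.
  - by apply: le_trans cl; exact: sle.
  - by move=> y hy; rewrite lee_fin indicE mem_set.
have disj i j y : A i y -> A j y -> i = j.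
  wlog ij : i j / (i < j)%N.
    move=> H Ai Aj; case: (ltngtP i j) => // ij; first exact: H.
    by apply/esym; exact: H.
  move=> /andP[i1 _] /andP[_ j2]; have := lt_trans (le_lt_trans (sle _ _ ij) i1) j2.
  by rewrite ltxx.
apply: (@le_trans _ _ (\int[mu]_y \sum_(j < N) (a j `^ p)%:E * (\1_(A j) y)%:E)%E).
  rewrite ppower_integralE; last by case: brho.
  apply: ge0_le_integral => //.
  - by move=> y _; exact: poweR_ge0.
  - exact: measurable_ppower.
  - by apply: emeasurable_sum => j; exact: measurable_funeM.
  move=> y _; rewrite /rho poweR_EFin.
  under [leRHS]eq_bigr do rewrite -EFinM.
  rewrite sumEFin lee_fin.
  (* By disjointness at most one term is nonzero at [y], so the [p]-th power passes inside the
     sum. *)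
  have [[j Aj]|nA] := pselect (exists j : 'I_N, A j y).
    have E (b : nat -> R) : \sum_(i < N) b i * \1_(A i) y = b j.
      rewrite (bigD1 j)//= big1 ?addr0; first by rewrite indicE mem_set// mulr1.
      move=> i ij; rewrite indicE memNset ?mulr0// => Ai.
      by move/eqP: ij; apply; apply/val_inj; exact: disj Ai Aj.
    by rewrite (E a) (E (fun i => a i `^ p)).
  have E (b : nat -> R) : \sum_(i < N) b i * \1_(A i) y = 0.
    rewrite big1// => i _; rewrite indicE memNset ?mulr0// => Ai.
    by apply: nA; exists i.
  by rewrite (E a) (E (fun i => a i `^ p)) powR0// gt_eqF.
rewrite ge0_integral_sum//; last 2 first.
- by move=> j; exact: measurable_funeM.
- by move=> j y _; rewrite mule_ge0// lee_fin ?powR_ge0.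
apply: lee_sum => j _; rewrite ge0_integralZl//; last by rewrite lee_fin powR_ge0.
rewrite lee_wpmul2l ?lee_fin ?powR_ge0// integral_indic// setIT.
apply: le_measure; rewrite ?inE; [exact: mA|exact: measurable_ball|].
by move=> y /andP[_]; rewrite ballEmdist.
Qed.

End annuli.

Lemma le_div_exp2 (R : realType) (r : R) (m n : nat) : 0 <= r -> (m <= n)%N ->
  r / 2 ^+ n <= r / 2 ^+ m.
Proof.
move=> r0 mn; rewrite ler_wpM2l// lef_pV2 ?posrE ?exprn_gt0//.
by rewrite ler_weXn2l// ler1n.
Qed.

Lemma powR_small (R : realType) (C eta d : R) : 0 < C -> 0 < eta -> 0 < d ->
  exists2 t0, 0 < t0 & forall t, 0 <= t -> t <= t0 -> C * t `^ eta <= d.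
Proof.
move=> C0 e0 d0; exists ((d / C) `^ eta^-1) => [|t t0 tt]; first by rewrite powR_gt0// divr_gt0.
rewrite mulrC -ler_pdivlMr//.
rewrite -[leRHS]powRr1 ?divr_ge0 ?(ltW d0) ?(ltW C0)// -(mulVf (lt0r_neq0 e0)) powRrM.
by apply: ge0_ler_powR; rewrite ?nnegrE ?(ltW e0) ?powR_ge0.
Qed.

(** * Vanishing modulus at a boundary point *)

Section vanishing_modulus.
Context {R : realType} {X : completeMetricType R}.
Variables (mu : {measure set (borel X) -> \bar R}) (p : R) (x : X).
Hypotheses (mu_ball : forall (a : X) (r : R), 0 < r -> (0 < mu (ball a r) < +oo)%E)
  (p_ge1 : 1 <= p) (Qp : dimension_set mu x p)
  (Q1 : dimension_set mu x <> [set q | 0 < q <= 1]).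

Lemma dimension_bound q : dimension_set mu x q ->
  exists C s : R, [/\ 0 < C, 0 < s & forall r, 0 < r -> r <= s ->
    (mu (ball x r) <= (C * r `^ q)%:E)%E].
Proof.
move=> [q0 [Cq [Rq [Cq0 Rq0 h]]]].
have fin r : 0 < r -> mu (ball x r) = (fine (mu (ball x r)))%:E.
  by move=> r0; have /andP[m0 moo] := mu_ball x r0; rewrite fineK// ge0_fin_numE// ltW.
have muR : 0 < fine (mu (ball x Rq)) by rewrite fine_gt0// mu_ball.
exists (Cq * Rq^-1 `^ q * fine (mu (ball x Rq))), Rq; split => //.
  by rewrite !mulr_gt0// powR_gt0// invr_gt0.
move=> r r0 rR; rewrite fin// lee_fin.
have := h _ _ r0 rR (lexx _); rewrite ler_pdivrMr// powRM ?invr_ge0 ?(ltW r0) ?(ltW Rq0)// => H.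
by apply: le_trans H _; rewrite le_eqVlt; apply/orP; left; apply/eqP; ring.
Qed.

(** As [r / s <= 1], an exponent 1 in the dimension set brings all smaller ones with it; without any
    exponent above 1 the set would be the excluded []0, 1]]. *)
Lemma dimension_gt1 : p = 1 -> exists2 q, 1 < q & dimension_set mu x q.
Proof.
move=> p1; move: Qp; rewrite p1 => -[_ [C [s [C0 s0 h]]]].
apply: contrapT => nq; apply: Q1; apply/seteqP; split=> q /=.
  move=> Qq; have q0 : 0 < q by case: Qq.
  by rewrite q0 leNgt; apply/negP => q1; apply: nq; exists q.
move=> /andP[q0 q1]; split => //; exists C, s; split => // r t r0 rt ts.
apply: le_trans (h _ _ r0 rt ts) _; rewrite ler_wpM2l ?(ltW C0)//.
have t0 := lt_le_trans r0 rt.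
by apply: ger_powR => //; rewrite divr_gt0//= ler_pdivrMr// mul1r.
Qed.

(** The annulus between radii [s j / 2] and [s j] has width [s j / 2], so the weight [2 / (N s j)]
    on it contributes [1 / N] to the integral along a crossing curve. The sum is the resulting bound
    on the modulus. *)
Lemma small_annuli (r d : R) (m0 : nat) : 0 < r -> 0 < d ->
  exists m N, [/\ (m0 <= m)%N, (0 < N)%N &
    let s j := r / 2 ^+ (m + j) in
    (\sum_(j < N) ((2 / (N%:R * s j)) `^ p)%:E * mu (ball x (s j)) <= d%:E)%E].
Proof.
move=> r0 d0.
have sgt0 m j : 0 < r / 2 ^+ (m + j) by rewrite divr_gt0// exprn_gt0.
have [p1|p1] : 1 < p \/ 1 = p.
  by have := p_ge1; rewrite le_eqVlt => /predU1P[|]; [right|left].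
  have [C [s0 [C0 s00 hC]]] := dimension_bound Qp.
  have eta0 : 0 < p - 1 by rewrite subr_gt0.
  have [t0 t00 ht] := powR_small (mulr_gt0 (ltr0Sn R 1) C0) eta0 d0.
  have [m1 hm1] := exists_div_exp2_lt (ltW r0) s00.
  (* Each term is at most [C (2 / N) ^ p], so the sum is at most [2 C (2 / N) ^ (p - 1)], which is
     at most [d] as [2 / N <= t0]. *)
  pose N := (Num.bound (2 / t0)).+1.
  have N0 : 0 < N%:R :> R by rewrite ltr0n.
  exists (maxn m0 m1), N; split => //; first exact: leq_maxl.
  set m := maxn m0 m1 => s.
  have tN : 2 / N%:R <= t0.
    rewrite ler_pdivrMr// mulrC -ler_pdivrMr// ltW//.
    apply: lt_trans (archi_boundP _) _; first by rewrite divr_ge0// ltW.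
    by rewrite ltr_nat.
  apply: (@le_trans _ _ (\sum_(j < N) (C * (2 / N%:R) `^ p)%:E)%E).
    apply: lee_sum => j _; have sj : 0 < s j by exact: sgt0.
    apply: (@le_trans _ _ (((2 / (N%:R * s j)) `^ p)%:E * (C * s j `^ p)%:E)%E).
      rewrite lee_wpmul2l ?lee_fin ?powR_ge0// hC//.
      apply: le_trans (ltW hm1); apply: le_div_exp2; first exact: ltW.
      by rewrite (leq_trans (leq_maxr m0 m1))// leq_addr.
    have a0 : 0 <= 2 / (N%:R * s j).
      by move: (s j) sj => y y0; rewrite divr_ge0// mulr_ge0// ltW.
    rewrite -EFinM lee_fin mulrCA -powRM//; last exact: ltW.
    have -> // : 2 / (N%:R * s j) * s j = 2 / N%:R.
    by move: (s j) sj => y y0; field; rewrite !gt_eqF.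
  rewrite sumEFin lee_fin sumr_const card_ord -[_ *+ N]mulr_natr.
  rewrite -mulr_powRB1 ?divr_ge0//; last by lra.
  apply: le_trans (ht _ _ tN); last by rewrite divr_ge0.
  rewrite le_eqVlt; apply/orP; left; apply/eqP.
  move: (N%:R) N0 => n n0; move: (_ `^ _) => y; field.
  by rewrite gt_eqF.
have [q q1 Qq] := dimension_gt1 (esym p1).
have [C [s0 [C0 s00 hC]]] := dimension_bound Qq.
have eta0 : 0 < q - 1 by rewrite subr_gt0.
have [t0 t00 ht] := powR_small (mulr_gt0 (ltr0Sn R 1) C0) eta0 d0.
have st0 : 0 < Num.min s0 t0 by rewrite lt_min s00.
have [m1 hm1] := exists_div_exp2_lt (ltW r0) st0.
(* For [p = 1] more annuli would not help; the single term is at most [2 C s ^ (q - 1)] with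
   [q > 1], which is small for a small radius. *)
exists (maxn m0 m1), 1%N; split => //; first exact: leq_maxl.
set m := maxn m0 m1 => s.
rewrite big_ord1 mul1r -p1 powRr1; last by rewrite divr_ge0// ltW// sgt0.
have s1 : 0 < s 0%N by exact: sgt0.
have : s 0%N < Num.min s0 t0.
  apply: le_lt_trans hm1; apply: le_div_exp2; first exact: ltW.
  by rewrite addn0 leq_maxr.
rewrite lt_min => /andP[ss0 st].
apply: (@le_trans _ _ ((2 / s 0%N)%:E * (C * s 0%N `^ q)%:E)%E).
  by rewrite lee_wpmul2l ?lee_fin ?divr_ge0 ?hC// ltW.
rewrite -EFinM lee_fin -mulr_powRB1 ?(ltW s1)//; last by lra.
apply: le_trans (ht _ (ltW s1) (ltW st)).
rewrite le_eqVlt; apply/orP; left; apply/eqP.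
move: (s 0%N) s1 => u u0; move: (_ `^ _) => y; field.
by rewrite gt_eqF.
Qed.

(** A compact subset of [Omega] misses a ball around [x], so a curve that reaches it from a late
    [E k] crosses all the annuli of [small_annuli]. *)
Lemma small_mod_chain (Omega : set X) (E : nat -> set X) (r : R) :
  chain Omega E -> 0 < r -> (forall k, E k `<=` ball x (r / 2 ^+ k)) ->
  ~ Omega x -> mod_chain mu p Omega E.
Proof.
move=> chE r0 Er nOx; split => // K cK KO.
have clK : closed K by apply: compact_closed cK; exact: metric_hausdorff.
have : nbhs x (~` K).
  by apply: open_nbhs_nbhs; split; [exact: closed_openC|move/KO].
move=> /nbhs_ballP[R1 /= R10 hR1].
have [m0 hm0] := exists_div_exp2_lt (ltW r0) R10.
have p0 : 0 < p by exact: lt_le_trans p_ge1.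
have small (d : R) : 0 < d -> exists k0, forall k, (k0 <= k)%N ->
    (modulus mu p (curves_between (E k) K Omega) <= d%:E)%E.
  move=> d0; have [m [N [m0m N0 /=]]] := small_annuli m0 r0 d0.
  set s := fun j => r / 2 ^+ (m + j) => hs.
  (* From this index on, [E k] lies in the innermost ball, of radius [s N]; by the choice of [m0],
     the ball of radius [s 0] misses [K]. *)
  exists (m + N)%N => k mNk; apply: le_trans hs.
  have sj j : s j - s j.+1 = s j / 2.
    by rewrite /s addnS exprS invfM; lra.
  have s0 j : 0 < s j by rewrite divr_gt0// exprn_gt0.
  have N0' : 0 < N%:R :> R by rewrite ltr0n.
  apply: (@modulus_annuli _ _ mu p x p0 _ N s (fun j => 2 / (N%:R * s j))).
  - by move=> j; have := sj j; have := s0 j; lra.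
  - by move=> j; rewrite divr_ge0// mulr_ge0// ltW.
  - move=> c [arc Ec Kc _]; split => //.
      have := Er _ _ Ec; rewrite ballEmdist /= => /ltW/le_trans; apply.
      by apply: le_div_exp2 => //; exact: ltW.
    rewrite leNgt; apply/negP => xc; apply: (hR1 (c.2 c.1)) Kc.
    rewrite ballEmdist /=; apply: lt_trans xc _; apply: le_lt_trans hm0.
    by rewrite /s addn0; apply: le_div_exp2 => //; exact: ltW.
  rewrite (eq_bigr (fun=> N%:R^-1)).
    by rewrite sumr_const card_ord -[_ *+ N]mulr_natr mulVf// gt_eqF.
  move=> j _; rewrite sj; have := s0 j; move: (s j) => y y0.
  by field; rewrite !gt_eqF.
apply/fine_cvgP; split.
  have [k0 hk0] := small 1 ltr01; exists k0 => // k /= /hk0 h.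
  by rewrite ge0_fin_numE ?modulus_ge0//; apply: le_lt_trans h (ltry _).
apply/cvgrPdist_le => d d0; have [k0 hk0] := small d d0.
exists k0 => // k /= /hk0 h.
rewrite sub0r normrN ger0_norm ?fine_ge0 ?modulus_ge0//.
rewrite -lee_fin fineK// ge0_fin_numE ?modulus_ge0//.
exact: le_lt_trans h (ltry _).
Qed.

End vanishing_modulus.

(** * Accessibility from one-point impressions, and the equivalences *)

Section quasiconvex_space.
Context {R : realType} {X : completeMetricType R}.
Variables (mu : {measure set (borel X) -> \bar R}) (p : R).
Hypotheses (mu_ball : forall (a : X) (r : R), 0 < r -> (0 < mu (ball a r) < +oo)%E)
  (p_ge1 : 1 <= p) (mu_doubling : doubling mu) (X_poincare : poincare mu p).

Lemma quasiconvex_paths : exists2 M : R, 0 < M & forall a b : X, exists g : R -> X,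
  [/\ continuous g, g 0 = a, g 1 = b & forall t, mdist a (g t) <= M * mdist a b].
Proof.
have [N N0 hN] := halving_chain mu_ball p_ge1 mu_doubling X_poincare.
have /choice[Z hZ] : forall ab : X * X, exists z : nat -> X, [/\ z 0%N = ab.1, z N = ab.2 &
    forall i, (i < N)%N -> mdist (z i) (z i.+1) <= mdist ab.1 ab.2 / 2].
  by move=> [a b]; exact: hN.
exists (N%:R + 1) => [|a b]; first by rewrite natr1 ltr0n.
apply: (@refine_path _ _ N (fun a b => Z (a, b)) a b N0) => [u v|u v|u v i iN].
- by case: (hZ (u, v)).
- by case: (hZ (u, v)).
- by case: (hZ (u, v)) => _ _; apply.
Qed.

(** A representative chain has a bounded first set and impression within [{x}], so
    [nested_impression_small] provides the shrinking that [chain_accessible] needs. *)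
Lemma accessible_of_end (Omega : set X) (x : X) (e : set (nat -> set X)) :
  is_end Omega e -> end_impression e = [set x] -> accessible Omega x.
Proof.
move=> [E0 chE0 eE] ex.
have [E Ee Ex] : (\bigcup_(E in e) impression E) x by rewrite -/(end_impression e) ex.
have [chE _] : chain Omega E /\ chain_equiv E0 E by move: Ee; rewrite eE.
have Esub : impression E `<=` [set x] by rewrite -ex => y Ey; exists E.
have [M M0 quasi] := quasiconvex_paths.
apply: (chain_accessible M0 quasi chE) => d d0.
have [a E0a] := chain_nonempty 0 chE.
case: (chE) => aE dE _ _; have [bE _ _ _] := aE 0%N.
have [r r0 hr] : exists2 r : R, 0 < r & E 0%N `<=` ball a r.
  have diam0 : (0 <= diam (E 0%N))%E.
    apply: le_ereal_sup_tmp; exists 0%E => //; exists a => //.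
    by exists a => //; rewrite mdistxx.
  have dfin : diam (E 0%N) \is a fin_num by rewrite ge0_fin_numE.
  exists (fine (diam (E 0%N)) + 1); first by rewrite ltr_wpDl// fine_ge0.
  move=> y Ey; rewrite ballEmdist /= (@le_lt_trans _ _ (fine (diam (E 0%N))))//.
    rewrite -lee_fin fineK//; apply: ereal_sup_ubound.
    by exists a => //; exists y.
  by rewrite ltrDl.
exact: (nested_impression_small mu_ball mu_doubling r0 d0 dE hr Esub).
Qed.

End quasiconvex_space.

Theorem corollary7p12 (R : realType) (X : completeMetricType R)
    (mu : {measure set (borel X) -> \bar R}) (p : R) (Omega : set X) (x : X)
    (X_nontrivial : exists a b : X, a <> b)
    (mu_ball : forall (a : X) (r : R), 0 < r -> (0 < mu (ball a r) < +oo)%E)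
    (p_ge1 : 1 <= p)
    (mu_doubling : doubling mu)
    (X_poincare : poincare mu p)
    (Omega_domain : bounded_domain Omega)
    (Omega_proper : Omega `<` [set: X])
    (x_boundary : boundary Omega x) :
  [<-> accessible Omega x;
       exists2 e, is_end Omega e & end_impression e = [set x];
       exists2 e, is_prime_end Omega e & end_impression e = [set x]] /\
  (dimension_set mu x p ->
   dimension_set mu x <> [set q | 0 < q <= 1] ->
   [<-> accessible Omega x;
        exists2 e, is_end Omega e & end_impression e = [set x];
        exists2 e, is_prime_end Omega e & end_impression e = [set x];
        exists2 e, is_mod_end mu p Omega e & end_impression e = [set x];
        exists2 e, is_mod_prime_end mu p Omega e & end_impression e = [set x]]).
Proof.
have [M M0 quasi] := quasiconvex_paths mu_ball p_ge1 mu_doubling X_poincare.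
have nOx : ~ Omega x.
  by case: Omega_domain => oO _ _ _; case: x_boundary => _ + Ox; rewrite (interior_id _).1.
have ac : accessible Omega x -> exists E (r : R), [/\ chain Omega E, 0 < r,
    forall k, E k `<=` ball x (r / 2 ^+ k), is_prime_end Omega (end_of Omega E) &
    end_impression (end_of Omega E) = [set x]].
  move=> /(accessible_chain M0 quasi Omega_domain x_boundary)[E [r [chE r0 Er Ex]]].
  have small e : 0 < e -> exists k, E k `<=` ball x e.
    move=> e0; have [k hk] := exists_div_exp2_lt (ltW r0) e0.
    by exists k; apply: subset_trans (Er k) _; apply: le_ball; exact: ltW.
  exists E, r; split => //; first exact: small_chain_prime chE small.
  exact: small_end_impression chE small Ex.
have ba : (exists2 e, is_end Omega e & end_impression e = [set x]) -> accessible Omega x.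
  by move=> [e he ex]; exact: (accessible_of_end mu_ball p_ge1 mu_doubling X_poincare he ex).
have prime_end : (exists2 e, is_prime_end Omega e & end_impression e = [set x]) ->
    exists2 e, is_end Omega e & end_impression e = [set x].
  by move=> [e [he _] ex]; exists e.
have aprime : accessible Omega x ->
    exists2 e, is_prime_end Omega e & end_impression e = [set x].
  by move=> /ac[E [r [_ _ _ pE Ex]]]; exists (end_of Omega E).
split.
  tfae => //.
  - by move=> /aprime/prime_end.
  - by move=> /ba/aprime.
  - by move=> /prime_end/ba.
move=> Qp Q1.
have amod : accessible Omega x ->
    exists2 e, is_mod_prime_end mu p Omega e & end_impression e = [set x].
  move=> /ac[E [r [chE r0 Er [eE primeE] Ex]]]; exists (end_of Omega E) => //.
  (* A [Mod_p]-end is in particular an end, so a prime end is not divisible by any other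
     [Mod_p]-end. *)
  split; last by move=> f [ef _]; exact: primeE.
  split => //; exists E; last exact: small_mod_chain Er nOx.
  by split => //; split; exact: chain_dividesxx.
have modend : (exists2 e, is_mod_end mu p Omega e & end_impression e = [set x]) ->
    accessible Omega x.
  by move=> [e [he _] ex]; apply: ba; exists e.
have modprime : (exists2 e, is_mod_prime_end mu p Omega e & end_impression e = [set x]) ->
    exists2 e, is_mod_end mu p Omega e & end_impression e = [set x].
  by move=> [e [he _] ex]; exists e.
tfae.
- by move=> /aprime/prime_end.
- by move=> /ba/aprime.
- by move=> /prime_end/ba/amod/modprime.
- by move=> /modend/amod.
- by move=> /modprime/modend.
Qed.
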